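(* Let $k\ge1$, let $\mathcal{I}\subset\mathbb{R}\setminus\{0\}$ be a finite set, and let $\lambda_j^{(i)}$, $i\in\mathcal{I}$, $1\le j\le k$, be positive constants. For $m,l,n\ge1$ let $p^{(n)}_{m,l,i,j}\in(0,1)$, $(i,j)\in\mathcal{I}\times\{1,\dots,k\}$, be such that $\sum_{i\in\mathcal{I}}\sum_{j=1}^kp^{(n)}_{m,l,i,j}<1$. Let $\{(X^{(n)}_{m,l},Y^{(n)}_{m,l})\}_{m,l,n\ge1}$ be random vectors, independent across $m$, $l$ and $n$, such that $$\Pr\{(X^{(n)}_{m,l},Y^{(n)}_{m,l})=(i,j)\}=p^{(n)}_{m,l,i,j},\quad(i,j)\in\mathcal{I}\times\{1,\dots,k\},$$ and $$\Pr\big\{(X^{(n)}_{m,l},Y^{(n)}_{m,l})\in\{(i,0),(0,j),(0,0)\}_{i\in\mathcal{I},\,1\le j\le k}\big\}=1-\sum_{i\in\mathcal{I}}\sum_{j=1}^kp^{(n)}_{m,l,i,j}.$$ For $n\ge1$ define $Z^{(n)}(s,t)=\sum_{m=1}^{[ns]}\sum_{l=1}^{[nt]}X^{(n)}_{m,l}Y^{(n)}_{m,l}$, $(s,t)\in\mathbb{R}^2_+$. Suppose that, as $n\to\infty$, for all $(i,j)\in\mathcal{I}\times\{1,\dots,k\}$, $$\sum_{m=1}^{[ns]}\sum_{l=1}^{[nt]}p^{(n)}_{m,l,i,j}\to\lambda_j^{(i)}st\ \text{ for all }(s,t)\in\mathbb{R}^2_+,\qquad\sup_{1\le m,l\le n}p^{(n)}_{m,l,i,j}\to0.$$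 Then for any $(s_1,t_1)\preceq(s_2,t_2)\preceq\dots\preceq(s_r,t_r)$ in $\mathbb{R}^2_+$, $$(Z^{(n)}(s_1,t_1),\dots,Z^{(n)}(s_r,t_r))\overset{d}{\to}(S(s_1,t_1),\dots,S(s_r,t_r))\quad\text{as }n\to\infty,$$ where $\{S(s,t),\ (s,t)\in\mathbb{R}^2_+\}\sim GSPP\{\lambda_j^{(i)},\ i\in\mathcal{I}\}_{1\le j\le k}$.
   Context: $\mathbb{R}_+=[0,\infty)$; $[x]$ is the integer part of $x$ (empty sums are $0$); $(s,t)\preceq(s',t')$ means $s\le s'$ and $t\le t'$; $\overset{d}{\to}$ is convergence in distribution. For a two parameter process $X$ and $(s,t)\preceq(s',t')$, the rectangular increment is $\Delta_{s,t}X(s',t')=X(s',t')-X(s',t)-X(s,t')+X(s,t)$. Two parameter generalized Poisson random field $\{M(s,t),\ (s,t)\in\mathbb{R}^2_+\}\sim GPRF\{\lambda_j\}_{1\le j\le k}$ ($\lambda_j>0$): a non-negative integer valued process with $M(0,t)=M(s,0)=0$ almost surely, with independent rectangular increments over disjoint rectangles $(s,s']\times(t,t']$, and with $$\Pr\{\Delta_{s,t}M(s',t')=n\}=\sum_{(n_1,\dots,n_k)\in\Theta(k,n)}\prod_{j=1}^{k}\frac{(\lambda_j(s'-s)(t'-t))^{n_j}}{n_j!}e^{-\lambda_j(s'-s)(t'-t)},\quad n\ge0,$$ where $\Theta(k,n)=\{(n_1,\dots,n_k)\in\mathbb{N}_0^k:\sum_{j=1}^kjn_j=n\}$. Generalized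 Skellam point process $GSPP\{\lambda_j^{(i)},\ i\in\mathcal{I}\}_{1\le j\le k}$: the process $S(s,t)=\sum_{i\in\mathcal{I}}iM_i(s,t)$, where $\{M_i(s,t)\}\sim GPRF\{\lambda_j^{(i)}\}_{1\le j\le k}$, $i\in\mathcal{I}$, are independent. *)

(* Defs.v *)
From HB Require Import structures.
From mathcomp Require Export all_boot all_order all_algebra finmap.
From mathcomp Require Export all_classical all_reals all_analysis.

Set Implicit Arguments.
Unset Strict Implicit.
Unset Printing Implicit Defensive.

Import Order.TTheory GRing.Theory Num.Theory numFieldNormedType.Exports.

Local Open Scope classical_set_scope.
Local Open Scope ring_scope.

Section plane.
Context {R : realType}.
Implicit Types u v : R * R.

Definition prec u v : Prop := u.1 <= v.1 /\ u.2 <= v.2.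

Definition quadrant : set (R * R) := [set u | 0 <= u.1 /\ 0 <= u.2].

Definition rect u v : set (R * R) :=
  [set w | u.1 < w.1 <= v.1 /\ u.2 < w.2 <= v.2].

Definition increment {T : Type} (X : R * R -> T -> R) u v : T -> R :=
  fun w => X v w - X (v.1, u.2) w - X (u.1, v.2) w + X u w.

End plane.

Notation "u ⪯ v" := (prec u v) (at level 70, no associativity).

Section independence.
Context {d} {T : measurableType d} {R : realType} (P : probability T R).

Definition independent_classes {I : choiceType} (D : set I)
    (F : I -> set (set T)) : Prop :=
  forall (J : {fset I}) (B : I -> set T),
    (forall i, i \in J -> D i) -> (forall i, i \in J -> F i (B i)) ->
    P (\bigcap_(i in [set` J]) B i) = (\prod_(i <- J) P (B i))%E.

Definition independent_RVs {I : choiceType} {d'} {S : measurableType d'}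
    (D : set I) (X : I -> T -> S) : Prop :=
  independent_classes D
    (fun i => preimage_set_system [set: T] (X i) measurable).

Definition process_sigma {I : Type} {d'} {S : measurableType d'}
    (D : set I) (X : I -> T -> S) : set (set T) :=
  <<s \bigcup_(u in D) preimage_set_system [set: T] (X u) measurable >>.

End independence.

(* The weak convergence of the laws; the X_ n and Y may live on different
   probability spaces. *)
Definition cvg_in_distribution {R : realType} {V : topologicalType}
    {d} {T : measurableType d} (P : probability T R) (X_ : nat -> T -> V)
    {d'} {T' : measurableType d'} (P' : probability T' R) (Y : T' -> V) : Prop :=
  forall f : V -> R, continuous f -> bounded_fun f ->
    'E_P[f \o X_ n]%E @[n --> \oo] --> 'E_P'[f \o Y]%E.

(* x j stands for n_(j+1); the bound n_j <= n is implied by the constraint, and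
   makes the index set a finite type. *)
Definition Theta (k n : nat) : {set {ffun 'I_k -> 'I_n.+1}} :=
  [set x : {ffun 'I_k -> 'I_n.+1} | (\sum_(j < k) j.+1 * x j)%N == n]%SET.

(* lambda is indexed from 1: only lambda 1, ..., lambda k are used. *)
Record is_GPRF {R : realType} {d} {T : measurableType d} (P : probability T R)
    (k : nat) (lambda : nat -> R) (M : R * R -> T -> nat) : Prop := IsGPRF {
  GPRF_measurable : forall u, quadrant u -> measurable_fun [set: T] (M u) ;
  GPRF_left0 : forall t, 0 <= t -> {ae P, forall w, M (0, t) w = 0%N} ;
  GPRF_bottom0 : forall s, 0 <= s -> {ae P, forall w, M (s, 0) w = 0%N} ;
  GPRF_independent : forall (N : nat) (u v : 'I_N -> R * R),
    (forall i, quadrant (u i)) -> (forall i, u i ⪯ v i) ->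
    trivIset [set: 'I_N] (fun i => rect (u i) (v i)) ->
    independent_RVs P [set: 'I_N]
      (fun i => increment (fun z w => (M z w)%:R : R) (u i) (v i)) ;
  GPRF_law : forall (u v : R * R) (n : nat), quadrant u -> u ⪯ v ->
    P [set w | increment (fun z w => (M z w)%:R : R) u v w = n%:R] =
    (\sum_(x in Theta k n) \prod_(j < k)
       ((lambda j.+1 * (v.1 - u.1) * (v.2 - u.2)) ^+ x j / (x j)`!%:R
        * expR (- (lambda j.+1 * (v.1 - u.1) * (v.2 - u.2)))))%:E }.

Definition is_GSPP {R : realType} {d} {T : measurableType d}
    (P : probability T R) (k : nat) (I : {fset R}) (lambda : R -> nat -> R)
    (S : R * R -> T -> R) : Prop :=
  exists M : R -> R * R -> T -> nat,
  [/\ forall i, i \in I -> is_GPRF P k (lambda i) (M i),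
      independent_classes P [set` I] (fun i => process_sigma quadrant (M i))
    & forall u w, quadrant u -> S u w = \sum_(i <- I) i * (M i u w)%:R].

(* Sums over 1 <= m <= [n s], 1 <= l <= [n t]; on s, t >= 0, Num.truncn is the
   integer part. *)
Definition box_sum {R : realType} (n : nat) (u : R * R) (a : nat -> nat -> R) : R :=
  \sum_(1 <= m < (Num.truncn (n%:R * u.1)).+1)
    \sum_(1 <= l < (Num.truncn (n%:R * u.2)).+1) a m l.

(* Main.v *)
(** Averaging operators [g |-> (x |-> E g (x + Y))] on bounded functions turn sums
    of independent variables into compositions of operators.  The operator of a
    cell with small mark probabilities [p] is bounded above, up to [C (sum p)^2]
    on functions with values in [0, C], by the compound Poisson operator with the
    same rates (the inequality [1 - p <= exp (- p)]).  Compound Poisson operators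
    commute, their rates add up under composition and they depend continuously on
    the rates; so [limsup E g (Z_n) <= E g (S)] for every continuous [g] with
    [0 <= g <= C], where [S] is split into counts of disjoint rectangles.  Applying
    this to [K + f] and to [K - f] gives the convergence of [E f (Z_n)].  The sums
    of squares vanish in the limit because a box can be cut into strips, each
    carrying little mass. *)
Require Import Defs.
From HB Require Import structures.
From mathcomp Require Import all_boot all_order all_algebra finmap.
From mathcomp Require Import all_classical all_reals all_analysis.
From mathcomp Require Import measurable_realfun ring lra.
Set Implicit Arguments.
Unset Strict Implicit.
Unset Printing Implicit Defensive.
Import Order.TTheory GRing.Theory Num.Theory numFieldNormedType.Exports.
Local Open Scope classical_set_scope.
Local Open Scope ring_scope.

(** * Averaging operators *)

Section shift_average.
Context {R : realType} {V : zmodType}.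
Implicit Types (q : nat -> R) (phi : nat -> V) (g h : V -> \bar R).
Local Open Scope ereal_scope.

(** Functions are nonnegative with values in [\bar R], so that every interchange of series is an
    instance of Tonelli and summability never has to be tracked. The joint law over several points
    is treated as the law of one sum of row vectors. The boxes are nested, so a cell that first
    appears in box [a] contributes its product along the row that has ones from position [a] on. The
    Skellam row has the same shape. The part of the plane between two consecutive boxes is L-shaped
    and is cut into two rectangles; the count of a rectangle, whose law is a sum over [Theta], is a
    sum of independent Poisson variables weighted by the jump sizes. Both sides thus become
    operators in the same finite family of directions, one per region and mark, and only their rates
    remain to be compared. The vectors of the array enter through finitely many labels, which are
    natural numbers; this turns expectations into series and makes independence a statement about
    cylinders. *)

Definition shift_avg q phi g (x : V) : \bar R :=
  \sum_(0 <= y <oo) (q y)%:E * g (x + phi y)%R.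

Lemma shift_avg_ge0 q phi g :
  (forall y, 0 <= q y)%R -> (forall x, 0 <= g x) ->
  forall x, 0 <= shift_avg q phi g x.
Proof.
move=> q0 g0 x; apply: nneseries_ge0 => y _ _.
by rewrite mule_ge0// lee_fin.
Qed.

Lemma le_shift_avg q phi g h :
  (forall y, 0 <= q y)%R -> (forall x, 0 <= g x) -> (forall x, g x <= h x) ->
  forall x, shift_avg q phi g x <= shift_avg q phi h x.
Proof.
move=> q0 g0 gh x; apply: lee_nneseries => [y _ _|y _].
  by rewrite mule_ge0// lee_fin.
by apply: lee_wpmul2l; rewrite ?lee_fin.
Qed.

Lemma shift_avgD q phi g h :
  (forall y, 0 <= q y)%R -> (forall x, 0 <= g x) -> (forall x, 0 <= h x) ->
  forall x, shift_avg q phi (fun x => g x + h x) x =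
            shift_avg q phi g x + shift_avg q phi h x.
Proof.
move=> q0 g0 h0 x; rewrite /shift_avg -nneseriesD.
- by apply: eq_eseriesr => y _; rewrite ge0_muleDr.
- by move=> y _ _; rewrite mule_ge0// lee_fin.
- by move=> y _ _; rewrite mule_ge0// lee_fin.
Qed.

Lemma shift_avg_cst q phi (c : R) :
  (forall y, 0 <= q y)%R -> (0 <= c)%R -> \sum_(0 <= y <oo) (q y)%:E = 1 ->
  forall x, shift_avg q phi (fun=> c%:E) x = c%:E.
Proof.
move=> q0 c0 q1 x; rewrite /shift_avg.
transitivity (\sum_(0 <= y <oo) c%:E * (q y)%:E).
  by apply: eq_eseriesr => y _; rewrite muleC.
by rewrite nneseriesZl ?q1 ?mule1// => y _; rewrite lee_fin.
Qed.

(** Tonelli for the double series; the two shifts commute because [V] is abelian. *)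
Lemma shift_avg_comm q phi q' phi' g :
  (forall y, 0 <= q y)%R -> (forall y, 0 <= q' y)%R -> (forall x, 0 <= g x) ->
  shift_avg q phi (shift_avg q' phi' g) = shift_avg q' phi' (shift_avg q phi g).
Proof.
move=> q0 q'0 g0; apply/funext => x; rewrite /shift_avg.
transitivity (\sum_(0 <= y <oo) \sum_(0 <= z <oo)
    (q y)%:E * ((q' z)%:E * g (x + phi y + phi' z)%R)).
  apply: eq_eseriesr => y _; rewrite nneseriesZl// => z _.
  by rewrite mule_ge0// lee_fin.
rewrite nneseries_interchange; last by move=> *; rewrite !mule_ge0// lee_fin.
apply: eq_eseriesr => y _; rewrite -nneseriesZl; last first.
  by move=> z _; rewrite mule_ge0// lee_fin.
by apply: eq_eseriesr => z _; rewrite muleCA addrAC.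
Qed.

Lemma shift_avg_fin q phi g x N :
  (forall y, 0 <= q y)%R -> (forall x, 0 <= g x) ->
  (forall y, (N <= y)%N -> q y = 0%R) ->
  shift_avg q phi g x = \sum_(0 <= y < N) (q y)%:E * g (x + phi y)%R.
Proof.
move=> q0 g0 qN; rewrite /shift_avg (nneseries_split 0 N); last first.
  by move=> *; rewrite mule_ge0// lee_fin.
by rewrite add0n eseries0 ?adde0// => y yN _; rewrite qN// mul0e.
Qed.

Lemma shift_avg_sum_le q phi g x N :
  (forall y, 0 <= q y)%R -> (forall x, 0 <= g x) ->
  \sum_(0 <= y < N) (q y)%:E * g (x + phi y)%R <= shift_avg q phi g x.
Proof.
move=> q0 g0; apply: nneseries_lim_ge => y _ _; by rewrite mule_ge0// lee_fin.
Qed.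

(** Law of [Y + d * Z] for independent [Y] of law [a] and [Z] of law [b]. When [0 < d], the range
    [i <= n] loses no term. *)
Definition dilated_conv (d : nat) (a b : nat -> R) (n : nat) : R :=
  (\sum_(i < n.+1 | (d * i <= n)%N) b i * a (n - d * i)%N)%R.

Lemma dilated_conv_ge0 d a b :
  (forall y, 0 <= a y)%R -> (forall y, 0 <= b y)%R ->
  forall n, (0 <= dilated_conv d a b n)%R.
Proof. by move=> a0 b0 n; apply: sumr_ge0 => i _; rewrite mulr_ge0. Qed.

Lemma eseries_shift (a : nat -> R) (H : nat -> \bar R) k :
  (forall y, 0 <= a y)%R -> (forall y, 0 <= H y) ->
  \sum_(0 <= n <oo) (a n)%:E * H (n + k)%N =
  \sum_(0 <= n <oo) (if (k <= n)%N then (a (n - k)%N)%:E * H n else 0).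
Proof.
move=> a0 H0.
set F := fun n => if (k <= n)%N then (a (n - k)%N)%:E * H n else 0.
have F0 n : 0 <= F n by rewrite /F; case: ifP => // _; rewrite mule_ge0// lee_fin.
rewrite (@nneseries_split _ F 0 k)// add0n big_nat_cond big1 ?add0e; last first.
  by move=> i; rewrite andbT /F => /andP[_ ik]; rewrite leqNgt ik.
rewrite -(@nneseries_addn _ F k)//; apply: eq_eseriesr => n _.
by rewrite /F leq_addl addnK.
Qed.

(** In units of [v], one average jumps by [Y] and the other by [d * Z], so that the composition
    jumps by [Y + d * Z]. *)
Lemma shift_avg_conv (a b : nat -> R) (v : V) d g :
  (0 < d)%N ->
  (forall y, 0 <= a y)%R -> (forall y, 0 <= b y)%R -> (forall x, 0 <= g x) ->
  shift_avg b (fun n => v *+ d *+ n)%R (shift_avg a (fun n => v *+ n)%R g) =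
  shift_avg (dilated_conv d a b) (fun n => v *+ n)%R g.
Proof.
move=> d0 a0 b0 g0; apply/funext => x; rewrite /shift_avg.
have bag i n : 0 <= (if (d * i <= n)%N then (b i * a (n - d * i)%N)%:E *
    g (x + v *+ n)%R else 0).
  by case: ifP => // _; rewrite mule_ge0// lee_fin mulr_ge0.
transitivity (\sum_(0 <= i <oo) \sum_(0 <= n <oo)
  (if (d * i <= n)%N then (b i * a (n - d * i)%N)%:E * g (x + v *+ n)%R else 0)).
  apply: eq_eseriesr => i _.
  have := @eseries_shift a (fun n => g (x + v *+ n)%R) (d * i) a0 (fun=> g0 _).
  under eq_eseriesr do rewrite mulrnDr [(v *+ _ + _)%R]addrC addrA mulrnA.
  move=> ->; rewrite -nneseriesZl; last first.
    by move=> n _; case: ifP => // _; rewrite mule_ge0// lee_fin.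
  by apply: eq_eseriesr => n _; case: ifP => // _; rewrite ?mule0// EFinM muleA.
rewrite nneseries_interchange//; apply: eq_eseriesr => n _.
(* For [i > n] the condition [d * i <= n] fails, since [0 < d]; the series over [i] stops at [n]. *)
rewrite (@nneseries_split _ _ 0 n.+1)// add0n [X in _ + X]eseries0 ?adde0; last first.
  move=> i ni _; case: ifP => // /(leq_trans _) H.
  by have := H _ (leq_pmull i d0); rewrite leqNgt ni.
rewrite /dilated_conv -sumEFin ge0_sume_distrl; last first.
  by move=> i _; rewrite lee_fin mulr_ge0.
by rewrite big_mkord -big_mkcond.
Qed.

End shift_average.

(** * Poisson laws and the operators that average over them *)

Section poisson_weights.
Context {R : realType}.

Definition pois (m : R) (n : nat) : R := m ^+ n / n`!%:R * expR (- m).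

Lemma pois_ge0 m : 0 <= m -> forall n, 0 <= pois m n.
Proof. by move=> m0 n; rewrite mulr_ge0 ?expR_ge0// divr_ge0// exprn_ge0. Qed.

Lemma pois_sum m : 0 <= m -> (\sum_(0 <= n <oo) (pois m n)%:E = 1)%E.
Proof.
move=> m0; transitivity ((expR (- m))%:E * (expR m)%:E)%E; last first.
  by rewrite -EFinM expRN mulVf ?gt_eqF ?expR_gt0.
under eq_eseriesr do rewrite /pois EFinM muleC.
rewrite nneseriesZl/=; last by move=> n _; rewrite lee_fin divr_ge0// exprn_ge0.
congr (_ * _)%E; rewrite expRE -EFin_lim; last first.
  rewrite /pseries/=; under eq_fun do rewrite mulrC.
  exact: is_cvg_series_exp_coeff.
apply/congr_lim/funext => n/=; rewrite /pseries/= /series/= -sumEFin//.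
by under eq_bigr do rewrite mulrC.
Qed.

(** The binomial theorem, in the form of the superposition of independent Poisson variables. *)
Lemma pois_conv m m' : dilated_conv 1 (pois m) (pois m') = pois (m + m').
Proof.
apply/funext => n; rewrite /dilated_conv /pois opprD expRD exprDn.
rewrite !mulr_suml; apply: congr_big => // [i|i _].
  by rewrite mul1n -ltnS ltn_ord.
have ni : (i <= n)%N by rewrite -ltnS.
have f0 (j : nat) : j`!%:R != 0 :> R by rewrite pnatr_eq0 -lt0n fact_gt0.
rewrite mul1n -(bin_fact ni) !natrM -mulr_natl; field.
by rewrite !f0 pnatr_eq0 -lt0n bin_gt0 ni.
Qed.

End poisson_weights.

Section poisson_operators.
Context {R : realType} {V : zmodType}.
Implicit Types (m : R) (v : V) (g h : V -> \bar R).
Local Open Scope ereal_scope.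

Definition pois_avg m v g : V -> \bar R := shift_avg (pois m) (fun n => v *+ n)%R g.

Lemma pois_avg0 v g : (forall x, 0 <= g x) -> pois_avg 0 v g = g.
Proof.
move=> g0; apply/funext => x; rewrite /pois_avg (@shift_avg_fin _ _ _ _ _ _ 1)//.
- by rewrite big_nat1 /pois expr0 oppr0 expR0 mulr1 divr1 mul1e mulr0n addr0.
- exact: pois_ge0.
- by move=> [|y]// _; rewrite /pois expr0n/= mul0r mul0r.
Qed.

Lemma pois_avgD m m' v g : (0 <= m)%R -> (0 <= m')%R -> (forall x, 0 <= g x) ->
  pois_avg m' v (pois_avg m v g) = pois_avg (m + m') v g.
Proof.
move=> m0 m'0 g0; rewrite {3}/pois_avg -pois_conv -shift_avg_conv//.
all: exact: pois_ge0.
Qed.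

Lemma pois_avg_ge0 m v g : (0 <= m)%R -> (forall x, 0 <= g x) ->
  forall x, 0 <= pois_avg m v g x.
Proof. by move=> m0 g0; apply: shift_avg_ge0 => //; exact: pois_ge0. Qed.

Lemma le_pois_avg m v g h : (0 <= m)%R -> (forall x, 0 <= g x) ->
  (forall x, g x <= h x) -> forall x, pois_avg m v g x <= pois_avg m v h x.
Proof. by move=> m0 g0; apply: le_shift_avg => //; exact: pois_ge0. Qed.

Lemma pois_avg_cst m v (c : R) : (0 <= m)%R -> (0 <= c)%R ->
  forall x, pois_avg m v (fun=> c%:E) x = c%:E.
Proof.
move=> m0 c0; apply: shift_avg_cst => //; [exact: pois_ge0|exact: pois_sum].
Qed.

Lemma pois_avg_le_cst m v (C : R) g : (0 <= m)%R -> (0 <= C)%R ->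
  (forall x, 0 <= g x) -> (forall x, g x <= C%:E) ->
  forall x, pois_avg m v g x <= C%:E.
Proof.
by move=> m0 C0 g0 gC x; rewrite -(pois_avg_cst v m0 C0 x); apply: le_pois_avg.
Qed.

Lemma pois_avg_comm m m' v v' g : (0 <= m)%R -> (0 <= m')%R ->
  (forall x, 0 <= g x) ->
  pois_avg m v (pois_avg m' v' g) = pois_avg m' v' (pois_avg m v g).
Proof. by move=> m0 m'0 g0; apply: shift_avg_comm => //; exact: pois_ge0. Qed.

Lemma pois_avg_add m v g h : (0 <= m)%R ->
  (forall x, 0 <= g x) -> (forall x, 0 <= h x) ->
  forall x, pois_avg m v (fun x => g x + h x) x = pois_avg m v g x + pois_avg m v h x.
Proof. by move=> m0 g0 h0 x; apply: shift_avgD => //; exact: pois_ge0. Qed.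

(** Only the events of no jump and of exactly one jump are kept. *)
Lemma pois_avg_ge1 m v g : (0 <= m)%R -> (forall x, 0 <= g x) ->
  forall x, (expR (- m))%:E * (g x + m%:E * g (x + v)%R) <= pois_avg m v g x.
Proof.
move=> m0 g0 x; apply: le_trans (shift_avg_sum_le _ _ 2 _ g0); last first.
  exact: pois_ge0.
rewrite big_nat_recl//= big_nat1 /pois !factE expr0 expr1 divr1 mul1r divr1.
rewrite mulr0n addr0 mulr1n ge0_muleDr// ?mule_ge0// ?lee_fin// muleA -EFinM.
by rewrite [(expR _ * _)%R]mulrC.
Qed.

(** The average preserves the constant [C], so the lower bound [expR (- m) * h] for the complement
    [h := C - g] is an upper bound for [g]. Then [1 - m <= expR (- m)] and [h <= C] give the error
    [C * m]. *)
Lemma pois_avg_small m v (C : R) g : (0 <= m)%R -> (0 <= C)%R ->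
  (forall x, 0 <= g x) -> (forall x, g x <= C%:E) ->
  forall x, pois_avg m v g x <= g x + (C * m)%:E.
Proof.
move=> m0 C0 g0 gC x.
pose h y := C%:E - g y.
have gfin y : g y \is a fin_num.
  by rewrite ge0_fin_numE// (le_lt_trans (gC y))// ltry.
have h0 y : 0 <= h y by rewrite sube_ge0// gfin.
have Qgh : pois_avg m v g x + pois_avg m v h x = C%:E.
  rewrite -(pois_avg_cst v m0 C0 x) -pois_avg_add//.
  by congr (pois_avg _ _ _ _); apply/funext => y; rewrite addeC subeK.
have Qg0 := pois_avg_ge0 v m0 g0 x.
have Qh1 : (expR (- m))%:E * h x <= pois_avg m v h x.
  apply: le_trans (pois_avg_ge1 v m0 h0 x); rewrite lee_wpmul2l ?lee_fin ?expR_ge0//.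
  by rewrite leeDl// mule_ge0.
have Qh0 := pois_avg_ge0 v m0 h0 x.
have Qgf : pois_avg m v g x \is a fin_num.
  by rewrite ge0_fin_numE// (le_lt_trans (pois_avg_le_cst v m0 C0 g0 gC x))// ltry.
have Qhf : pois_avg m v h x \is a fin_num.
  by rewrite ge0_fin_numE// (@le_lt_trans _ _ C%:E) ?ltry// -Qgh leeDr.
move: Qgh Qh1; rewrite /h -(fineK Qgf) -(fineK Qhf) -(fineK (gfin x)).
rewrite -!EFinD -!EFinM !lee_fin => -[bcC].
have e1 : (1 - m <= expR (- m))%R by rewrite expR_ge1Dx.
have aC : (fine (g x) <= C)%R by rewrite -lee_fin fineK.
have a0 : (0 <= fine (g x))%R by rewrite fine_ge0.
move: bcC e1 aC a0; move: (fine _) (fine _) (fine _) (expR _) => a b c e.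
nra.
Qed.

(** The larger rate is the smaller one followed by a further Poisson average at the rate of their
    difference. That average moves a function with values in [0, C] by at most [C] times its rate,
    downwards by [pois_avg_ge1] and upwards by [pois_avg_small]. *)
Lemma pois_avg_continuous m m' v (C : R) g :
  (0 <= m)%R -> (0 <= m')%R -> (0 <= C)%R ->
  (forall x, 0 <= g x) -> (forall x, g x <= C%:E) ->
  forall x, pois_avg m v g x <= pois_avg m' v g x + (C * `|m - m'|)%:E.
Proof.
move=> m0 m'0 C0 g0 gC x; have [mm'|/ltW mm'] := leP m m'.
  have d0 : (0 <= m' - m)%R by rewrite subr_ge0.
  have -> : m' = (m + (m' - m))%R by rewrite addrC subrK.
  rewrite -pois_avgD// opprD addrA subrr add0r normrN ger0_norm//.
  set d := (m' - m)%R in d0 *; set h := pois_avg m v g.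
  have h0 : forall y, 0 <= h y by apply: pois_avg_ge0.
  have hC : forall y, h y <= C%:E by apply: pois_avg_le_cst.
  have hf y : h y \is a fin_num.
    by rewrite ge0_fin_numE// (le_lt_trans (hC y))// ltry.
  apply: (@le_trans _ _ ((expR (- d))%:E * h x + (C * d)%:E)); last first.
    rewrite leeD2r//; apply: le_trans (pois_avg_ge1 v d0 h0 x).
    by rewrite lee_wpmul2l ?lee_fin ?expR_ge0// leeDl// mule_ge0.
  move: (hC x) (h0 x); rewrite -(fineK (hf x)) -EFinM -EFinD !lee_fin.
  by have := expR_ge1Dx (- d); nra.
have d0 : (0 <= m - m')%R by rewrite subr_ge0.
rewrite -{1}(subrK m' m) -pois_avgD// ger0_norm//.
set d := (m - m')%R in d0 *.
have Cd : (0 <= C * d)%R by rewrite mulr_ge0.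
rewrite -[X in _ + X](pois_avg_cst v m'0 Cd x) -pois_avg_add//.
apply: le_pois_avg => //; first exact: pois_avg_ge0.
exact: pois_avg_small.
Qed.

End poisson_operators.

(* Otherwise [done] may unfold the nested series. *)
#[local] Opaque pois_avg.

(** * Independent Poisson jumps in finitely many directions *)

Section multi_poisson.
Context {R : realType} {V : zmodType} {A : finType} (v : A -> V).
Implicit Types (mu : A -> R) (g h : V -> \bar R) (s : seq A).
Local Open Scope ereal_scope.

Definition pois_seq mu s g := foldr (fun a => pois_avg (mu a) (v a)) g s.

(** The compound Poisson operator with jumps [v a] at rates [mu a], written as a composition along
    [enum A] so that its properties follow by induction on a list. *)
Definition multi_pois mu g := pois_seq mu (enum A) g.

Lemma pois_seq_ge0 mu s g : (forall a, 0 <= mu a)%R -> (forall x, 0 <= g x) ->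
  forall x, 0 <= pois_seq mu s g x.
Proof. by move=> mu0 g0; elim: s => //= a s IH; apply: pois_avg_ge0. Qed.

Lemma pois_seq_le_cst mu s g (C : R) :
  (forall a, 0 <= mu a)%R -> (0 <= C)%R -> (forall x, 0 <= g x) ->
  (forall x, g x <= C%:E) -> forall x, pois_seq mu s g x <= C%:E.
Proof.
move=> mu0 C0 g0 gC; elim: s => //= a s IH.
by apply: pois_avg_le_cst => //; exact: pois_seq_ge0.
Qed.

Lemma pois_seq_commr mu s m w g : (forall a, 0 <= mu a)%R -> (0 <= m)%R ->
  (forall x, 0 <= g x) ->
  pois_seq mu s (pois_avg m w g) = pois_avg m w (pois_seq mu s g).
Proof.
move=> mu0 m0 g0; elim: s => [//|a s /= ->]; apply: pois_avg_comm => //.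
exact: pois_seq_ge0.
Qed.

(** Commutation brings together the two factors of each direction, whose rates then add up. *)
Lemma multi_poisD mu mu' g :
  (forall a, 0 <= mu a)%R -> (forall a, 0 <= mu' a)%R -> (forall x, 0 <= g x) ->
  multi_pois mu (multi_pois mu' g) = multi_pois (fun a => mu a + mu' a)%R g.
Proof.
move=> mu0 mu'0 g0; rewrite /multi_pois; elim: (enum A) => [//|a s IH] /=.
have h0 := pois_seq_ge0 s mu'0 g0.
rewrite (pois_seq_commr _ _ mu0 (mu'0 a) h0).
rewrite (pois_avgD _ (mu'0 a) (mu0 a) (pois_seq_ge0 s mu0 h0)).
by rewrite addrC IH.
Qed.

Lemma multi_pois_single a m g : (0 <= m)%R -> (forall x, 0 <= g x) ->
  multi_pois (fun b => if b == a then m else 0%R) g = pois_avg m (v a) g.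
Proof.
move=> m0 g0; rewrite /multi_pois; set mu := fun b => _.
have mu0 b : (0 <= mu b)%R by rewrite /mu; case: ifP.
have notin s : a \notin s -> pois_seq mu s g = g.
  elim: s => //= b s IH; rewrite inE negb_or => /andP[ab /IH ->].
  by rewrite /mu eq_sym (negbTE ab) pois_avg0.
have := mem_enum A a; have := enum_uniq A; elim: (enum A) => [//|b s IH] /=.
move=> /andP[bs us]; rewrite [in _ \in _]inE => /orP[/eqP ab|aS].
  have -> : mu b = m by rewrite /mu -ab eqxx.
  by rewrite notin ab.
rewrite (IH us aS); have -> : mu b = 0%R.
  by rewrite /mu; case: eqP => // ba; rewrite ba aS in bs.
by rewrite pois_avg0 => // x; apply: pois_avg_ge0.
Qed.

Lemma multi_pois0 g : (forall x, 0 <= g x) -> multi_pois (fun=> 0%R) g = g.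
Proof.
move=> g0; rewrite /multi_pois; elim: (enum A) => [//|a s /= ->].
exact: pois_avg0.
Qed.

Lemma eq_multi_pois mu mu' g : mu =1 mu' -> multi_pois mu g = multi_pois mu' g.
Proof. by move=> /funext ->. Qed.

Lemma multi_pois_ge0 mu g : (forall a, 0 <= mu a)%R -> (forall x, 0 <= g x) ->
  forall x, 0 <= multi_pois mu g x.
Proof. by move=> mu0 g0; apply: pois_seq_ge0. Qed.

Lemma multi_pois_le_cst mu g (C : R) :
  (forall a, 0 <= mu a)%R -> (0 <= C)%R -> (forall x, 0 <= g x) ->
  (forall x, g x <= C%:E) -> forall x, multi_pois mu g x <= C%:E.
Proof. by move=> mu0 C0 g0 gC; apply: pois_seq_le_cst. Qed.

Local Opaque multi_pois.

Lemma multi_pois_sum (J : Type) (s : seq J) (mu_ : J -> A -> R) g :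
  (forall j a, 0 <= mu_ j a)%R -> (forall x, 0 <= g x) ->
  foldr (fun j => multi_pois (mu_ j)) g s =
  multi_pois (fun a => \sum_(j <- s) mu_ j a)%R g.
Proof.
move=> mu0 g0; elim: s => [|j s /= ->].
  have /eq_multi_pois -> : (fun a => \sum_(j <- [::]) mu_ j a)%R =1 (fun=> 0%R).
    by move=> a; rewrite big_nil.
  by rewrite (multi_pois0 g0).
have S0 a : (0 <= \sum_(j <- s) mu_ j a)%R by apply: sumr_ge0.
rewrite (multi_poisD (mu0 j) S0 g0); apply: eq_multi_pois => a.
by rewrite big_cons.
Qed.

Local Transparent multi_pois.

(** The rates are changed one direction at a time. The error already made is a constant, which the
    next average leaves as it is. *)
Lemma multi_pois_continuous mu mu' (C : R) g :
  (forall a, 0 <= mu a)%R -> (forall a, 0 <= mu' a)%R -> (0 <= C)%R ->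
  (forall x, 0 <= g x) -> (forall x, g x <= C%:E) ->
  forall x, multi_pois mu g x <=
    multi_pois mu' g x + (C * \sum_(a : A) `|mu a - mu' a|)%:E.
Proof.
move=> mu0 mu'0 C0 g0 gC; rewrite /multi_pois -big_enum.
elim: (enum A) => [|a s IH] x; first by rewrite big_nil mulr0 adde0.
rewrite [pois_seq mu _ _]/= [pois_seq mu' _ _]/=.
set D := (\sum_(b <- s) _)%R in IH *.
have D0 : (0 <= C * D)%R by rewrite mulr_ge0// sumr_ge0.
apply: (@le_trans _ _ (pois_avg (mu' a) (v a) (pois_seq mu s g) x +
    (C * `|mu a - mu' a|)%:E)).
  exact: (pois_avg_continuous _ (mu0 a) (mu'0 a) C0 (pois_seq_ge0 s mu0 g0)
    (pois_seq_le_cst s mu0 C0 g0 gC)).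
rewrite big_cons mulrDr EFinD [leLHS]addeC [leRHS]addeCA; apply: leeD2l.
rewrite -[X in _ + X](pois_avg_cst (v a) (mu'0 a) D0 x).
have D0' (y : V) : 0 <= (C * D)%:E by rewrite lee_fin.
rewrite -(pois_avg_add (v a) (mu'0 a) (pois_seq_ge0 s mu'0 g0) D0').
exact: (le_pois_avg _ (mu'0 a) (pois_seq_ge0 s mu0 g0) IH).
Qed.

(** Only the configurations with at most one jump in total are kept. *)
Lemma pois_seq_ge1 mu s g : (forall a, 0 <= mu a)%R -> (forall x, 0 <= g x) ->
  forall x, (expR (- \sum_(a <- s) mu a))%:E *
      (g x + \sum_(a <- s) (mu a)%:E * g (x + v a)%R) <= pois_seq mu s g x.
Proof.
move=> mu0 g0; elim: s => [|a s IH] x /=.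
  by rewrite !big_nil oppr0 expR0 mul1e adde0.
have h0 := pois_seq_ge0 s mu0 g0.
apply: le_trans (pois_avg_ge1 (v a) (mu0 a) h0 x).
rewrite !big_cons opprD expRD EFinM -muleA lee_wpmul2l ?lee_fin ?expR_ge0//.
have S0 y : 0 <= \sum_(b <- s) (mu b)%:E * g (y + v b)%R.
  by rewrite sume_ge0// => b _; rewrite mule_ge0// lee_fin.
have ma : 0 <= (mu a)%:E * g (x + v a)%R by rewrite mule_ge0// lee_fin.
rewrite addeCA addeC ge0_muleDr//; last by rewrite adde_ge0.
apply: leeD; first exact: IH.
rewrite muleCA lee_wpmul2l ?lee_fin//; apply: le_trans (IH _).
by rewrite lee_wpmul2l ?lee_fin ?expR_ge0// leeDl.
Qed.

(** Let [S] be the total rate and [T] the one-jump term. The Poisson side is at least [expR (- S) *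
    (g x + T) >= (1 - S) * (g x + T)], which falls short of the left-hand side by
    [S * T <= C * S ^+ 2]. *)
Lemma multi_pois_ge_bernoulli mu (C : R) g :
  (forall a, 0 <= mu a)%R -> (\sum_(a : A) mu a <= 1)%R -> (0 <= C)%R ->
  (forall x, 0 <= g x) -> (forall x, g x <= C%:E) ->
  forall x, (1 - \sum_(a : A) mu a)%:E * g x + \sum_(a : A) (mu a)%:E * g (x + v a)%R
    <= multi_pois mu g x + (C * (\sum_(a : A) mu a) ^+ 2)%:E.
Proof.
move=> mu0 mu1 C0 g0 gC x.
apply: le_trans (leeD2r _ (pois_seq_ge1 (enum A) mu0 g0 x)).
rewrite !big_enum/=.
have gf y : g y \is a fin_num by rewrite ge0_fin_numE// (le_lt_trans (gC y))// ltry.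
pose G := fine \o g.
have gE y : g y = (G y)%:E by rewrite /G/= fineK.
have G0 y : (0 <= G y)%R by rewrite -lee_fin -gE.
have GC y : (G y <= C)%R by rewrite -lee_fin -gE.
have -> : \sum_(a : A) (mu a)%:E * g (x + v a)%R =
    (\sum_(a : A) mu a * G (x + v a))%R%:E.
  by rewrite -sumEFin; apply: eq_bigr => a _; rewrite gE EFinM.
rewrite gE -!EFinM -!EFinD lee_fin.
set S := (\sum_(a : A) mu a)%R in mu1 *.
set T := (\sum_(i : A) _ * _)%R.
have T0 : (0 <= T)%R by rewrite sumr_ge0// => i _; rewrite mulr_ge0.
have S0 : (0 <= S)%R by rewrite sumr_ge0.
have TS : (T <= C * S)%R.
  by rewrite mulr_sumr ler_sum// => i _; rewrite mulrC ler_wpM2r.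
have := expR_ge1Dx (- S); move: (expR _) (G0 x) => e Gx0 eS.
nra.
Qed.

End multi_poisson.

#[local] Opaque multi_pois.

(** * From a chain of cell operators to a Poisson operator *)

Section bernoulli_chain.
Context {R : realType} {V : zmodType} {A : finType} (v : A -> V).
Local Open Scope ereal_scope.

Lemma foldr_shift_avg_ge0 (J : Type) (s : seq J) (q : J -> nat -> R)
    (phi : J -> nat -> V) (g : V -> \bar R) :
  (forall j y, 0 <= q j y)%R -> (forall x, 0 <= g x) ->
  forall x, 0 <= foldr (fun j => shift_avg (q j) (phi j)) g s x.
Proof.
by move=> q0 g0; elim: s => [//|j s IH] /=; apply: shift_avg_ge0.
Qed.

(** Replacement of one factor at a time. The factors already replaced give a function with values in
    [0, C], to which the bound for a single cell applies; the error made so far is a constant,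
    preserved because [q j] has mass 1. *)
Lemma bernoulli_chain (J : Type) (s : seq J) (q : J -> nat -> R)
    (phi : J -> nat -> V) (mu_ : J -> A -> R) (C : R) (g : V -> \bar R) :
  (forall j y, 0 <= q j y)%R -> (forall j, \sum_(0 <= y <oo) (q j y)%:E = 1) ->
  (forall j a, 0 <= mu_ j a)%R -> (forall j, \sum_(a : A) mu_ j a <= 1)%R ->
  (forall j h, (forall x, 0 <= h x) -> forall x, shift_avg (q j) (phi j) h x =
    (1 - \sum_(a : A) mu_ j a)%:E * h x +
    \sum_(a : A) (mu_ j a)%:E * h (x + v a)%R) ->
  (0 <= C)%R -> (forall x, 0 <= g x) -> (forall x, g x <= C%:E) ->
  forall x, foldr (fun j => shift_avg (q j) (phi j)) g s x <=
    multi_pois v (fun a => \sum_(j <- s) mu_ j a)%R g x +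
    (C * \sum_(j <- s) (\sum_(a : A) mu_ j a) ^+ 2)%:E.
Proof.
move=> q0 q1 mu0 mu1 bern C0 g0 gC.
rewrite -(multi_pois_sum v s mu0 g0); elim: s => [|j s IH] x.
  by rewrite /= big_nil mulr0 adde0.
rewrite [foldr _ _ _]/= [X in _ <= X + _]/=.
set h := foldr (fun j => multi_pois v (mu_ j)) g s in IH *.
have S0 a : (0 <= \sum_(j <- s) mu_ j a)%R by apply: sumr_ge0.
have h0 y : 0 <= h y by rewrite /h (multi_pois_sum v s mu0 g0); apply: multi_pois_ge0.
have hC y : h y <= C%:E.
  by rewrite /h (multi_pois_sum v s mu0 g0); apply: multi_pois_le_cst.
set K := (\sum_(i <- s) _)%R in IH.
have K0 : (0 <= C * K)%R by rewrite mulr_ge0// sumr_ge0// => i _; apply: sqr_ge0.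
have K0' (y : V) : 0 <= (C * K)%:E by rewrite lee_fin.
apply: (le_trans (le_shift_avg (phi j) (q0 j) (foldr_shift_avg_ge0 s phi q0 g0) IH x)).
rewrite (shift_avgD (phi j) (q0 j) h0 K0') (shift_avg_cst (phi j) (q0 j) K0 (q1 j)).
rewrite big_cons mulrDr EFinD addeA; apply: leeD2r.
rewrite (bern j h h0); exact: multi_pois_ge_bernoulli.
Qed.

End bernoulli_chain.

(** * The law of a GPRF on one rectangle *)

Section theta.
Context {R : realType} {V : zmodType} (k : nat) (m : 'I_k -> R).
Hypothesis m0 : forall j, 0 <= m j.

Definition theta_weight (n : nat) : R :=
  \sum_(x in Theta k n) \prod_(j < k) pois (m j) (x j).

(** Law of the sum over [j] in [s] of [j.+1] times independent Poisson variables of means [m j],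
    built up from the point mass at 0. *)
Definition iter_conv (s : seq 'I_k) : nat -> R :=
  foldr (fun (j : 'I_k) a => dilated_conv j.+1 a (pois (m j))) (fun n => (n == 0)%:R) s.

Lemma iter_conv_ge0 s n : 0 <= iter_conv s n.
Proof.
elim: s n => [|j s IH] n /=; first exact: ler0n.
by apply: dilated_conv_ge0 => //; exact: pois_ge0.
Qed.

Lemma shift_avg_iter_conv s (v : V) (g : V -> \bar R) :
  (forall x, 0 <= g x)%E ->
  shift_avg (iter_conv s) (fun n => v *+ n) g =
  foldr (fun j : 'I_k => pois_avg (m j) (v *+ j.+1)) g s.
Proof.
move=> g0; elim: s => [|j s IH].
  apply/funext => x; rewrite (@shift_avg_fin _ _ _ _ _ _ 1)//.
  - by rewrite big_nat1 mul1e mulr0n addr0.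
  - by move=> [].
have a0 n := iter_conv_ge0 s n.
have := @shift_avg_conv _ V (iter_conv s) (pois (m j)) v j.+1 g isT a0 (pois_ge0 (m0 j)) g0.
by rewrite IH => <-.
Qed.

(* Truncating the Poisson generating functions at degree [n] does not affect
   the coefficients of degree at most [n] of their product. *)
Lemma iter_conv_coef n s n' : (n' <= n)%N ->
  iter_conv s n' =
  (\prod_(j <- s) \sum_(i < n.+1) pois (m j) i *: 'X^(j.+1 * i))`_n'.
Proof.
elim: s n' => [|j s IH] n' n'n /=; first by rewrite big_nil coef1.
rewrite big_cons mulr_suml coef_sum /dilated_conv.
rewrite (big_ord_widen_cond n.+1 (fun i => (j.+1 * i <= n')%N)
  (fun i => pois (m j) i * iter_conv s (n' - j.+1 * i)%N))//.
rewrite [LHS]big_mkcond; apply: eq_bigr => i _.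
rewrite -[in RHS]scalerAl coefZ coefXnM.
have [ji|nji] := leqP (j.+1 * i)%N n'; last by rewrite mulr0.
have -> : (i < n'.+1)%N by rewrite ltnS (leq_trans _ ji)// leq_pmull.
by rewrite /= IH// (leq_trans (leq_subr _ _)).
Qed.

(** Expanding the product of the truncated generating polynomials gives one monomial per tuple with
    entries in ['I_n.+1]; the coefficient of degree [n] retains the tuples of [Theta k n]. *)
Lemma iter_conv_theta n : iter_conv (enum 'I_k) n = theta_weight n.
Proof.
rewrite (@iter_conv_coef n)// big_enum/= bigA_distr_bigA coef_sum/=.
rewrite /theta_weight [RHS]big_mkcond/=; apply: eq_bigr => f _.
rewrite scaler_prod prodrXr coefZ coefXn inE eq_sym.
by case: eqP => _; rewrite ?mulr1 ?mulr0.
Qed.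

Lemma theta_weight_ge0 n : 0 <= theta_weight n.
Proof. by rewrite -iter_conv_theta iter_conv_ge0. Qed.

(** The bridge from the defining law of a GPRF to Poisson operators: a count consists of independent
    Poisson numbers of batches of sizes 1 to [k]. *)
Lemma shift_avg_theta (v : V) (g : V -> \bar R) : (forall x, 0 <= g x)%E ->
  shift_avg theta_weight (fun n => v *+ n) g =
  foldr (fun j : 'I_k => pois_avg (m j) (v *+ j.+1)) g (enum 'I_k).
Proof.
move=> g0; rewrite -shift_avg_iter_conv//.
by congr shift_avg; apply/funext => n; rewrite iter_conv_theta.
Qed.

End theta.

(** Read off from the operator identity at the constant function 1, which every Poisson average
    fixes. *)
Lemma theta_weight_sum {R : realType} (k : nat) (m : 'I_k -> R) :
  (forall j, 0 <= m j) -> (\sum_(0 <= n <oo) (theta_weight m n)%:E = 1)%E.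
Proof.
move=> m0.
have g0 (x : R) : (0 <= (fun=> 1%:E : \bar R) x)%E by rewrite lee_fin.
have /(congr1 (fun f => f 0)) := shift_avg_theta m0 0 g0.
rewrite /shift_avg => H.
transitivity (\sum_(0 <= y <oo) (theta_weight m y)%:E * (1%:E : \bar R))%E.
  by apply: eq_eseriesr => y _; rewrite mule1.
rewrite H.
suff -> : foldr (fun j : 'I_k => pois_avg (m j) ((0 : R) *+ j.+1))
    (fun=> 1%:E) (enum 'I_k) = (fun=> 1%:E : \bar R) by [].
elim: (enum 'I_k) => [//|i s /= ->].
by apply/funext => x; apply: pois_avg_cst.
Qed.

(** * Expectations of functions of independent sums *)

Section discrete_labels.
Context {d} {T : measurableType d}.

Lemma measurable_fun_label {C : countType} {d'} {U : measurableType d'}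
    (Y : T -> C) (H : C -> T -> U) :
  (forall c, measurable [set w | Y w = c]) ->
  (forall c, measurable_fun setT (H c)) ->
  measurable_fun setT (fun w => H (Y w) w).
Proof.
move=> mY mH _ B mB; rewrite setTI.
have -> : (fun w => H (Y w) w) @^-1` B =
    \bigcup_c ([set w | Y w = c] `&` H c @^-1` B).
  apply/seteqP; split => [w Bw|w [c _ [<-]]//].
  by exists (Y w).
apply: countable_bigcupT_measurable => [|c]; first exact: countableP.
by apply: measurableI => //; rewrite -[_ @^-1` _]setTI; apply: mH.
Qed.

(** [V] has no sigma-algebra here and [G] is arbitrary: measurability comes from the countable range
    of the labels. *)
Lemma measurable_sum_labels {C : countType} {d'} {U : measurableType d'}
    {V : zmodType} (J : Type) (s : seq J) (Y : J -> T -> C) (phi : J -> C -> V)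
    (G : V -> U) :
  (forall j c, measurable [set w | Y j w = c]) ->
  measurable_fun setT (fun w => G (\sum_(j <- s) phi j (Y j w))).
Proof.
move=> mY; elim: s G => [|j s IH] G.
  by under eq_fun do rewrite big_nil; exact: measurable_cst.
under eq_fun do rewrite big_cons.
exact: (measurable_fun_label (mY j) (fun c => IH (fun x => G (phi j c + x)))).
Qed.

End discrete_labels.

(* [f] is applied to the row rounded to the grid of mesh 1/(N+1), which takes
   countably many values, and continuity lets N tend to infinity. *)
Lemma measurable_continuous_row {R : realType} {d} {T : measurableType d}
    (r : nat) (f : 'rV[R]_r -> R) (X : 'I_r -> T -> R) :
  continuous f -> (forall a, measurable_fun setT (X a)) ->
  measurable_fun setT (fun w => f (\row_a X a w)).
Proof.
move=> cf mX.
pose Y N a w : int := Num.floor (N.+1%:R * X a w).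
pose phi N a (z : int) : 'rV[R]_r := (z%:~R / N.+1%:R) *: delta_mx 0 a.
have phiE N w : \sum_(a <- enum 'I_r) phi N a (Y N a w) =
    \row_a ((Y N a w)%:~R / N.+1%:R).
  rewrite big_enum/=; apply/rowP => b; rewrite summxE (bigD1 b)//= !mxE !eqxx mulr1.
  rewrite big1 ?addr0// => a ab.
  by rewrite !mxE eqxx/= eq_sym (negbTE ab) mulr0.
pose F N w := f (\sum_(a <- enum 'I_r) phi N a (Y N a w)).
apply: (@measurable_fun_cvg _ _ _ _ F) => [N|w _].
  apply: measurable_sum_labels => a z.
  have -> : [set w | Y N a w = z] =
      (fun w => N.+1%:R * X a w) @^-1` [set` `[z%:~R, (z + 1)%:~R[].
    apply/seteqP; split => w /=; rewrite in_itv/= /Y.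
      by move=> <-; rewrite ge_floor floorD1_gt.
    by move/floor_def.
  rewrite -[X in measurable X]setTI.
  by apply: measurable_funM => //; exact: measurable_cst.
have : (\sum_(a <- enum 'I_r) phi N a (Y N a w)) @[N --> \oo] --> \row_a X a w.
  apply/cvg_ballP => e e0; near=> N.
  split=> // i a; rewrite phiE !mxE /ball/=.
  have N0 : 0 < N.+1%:R :> R by rewrite ltr0n.
  have Ne : N.+1%:R^-1 < e by near: N; exact: (near_infty_natSinv_lt (PosNum e0)).
  apply: le_lt_trans Ne.
  have := ge_floor (N.+1%:R * X a w); have := floorD1_gt (N.+1%:R * X a w).
  rewrite -/(Y N a w) intrD => h1 h2.
  have -> : X a w - (Y N a w)%:~R / N.+1%:R =
      (N.+1%:R * X a w - (Y N a w)%:~R) / N.+1%:R.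
    by rewrite mulrBl mulrAC divff ?gt_eqF// mul1r.
  rewrite ger0_norm; last by rewrite divr_ge0 ?subr_ge0// ltW.
  by rewrite ler_pdivrMr// mulVf ?gt_eqF// lerBlDr addrC ltW.
by move=> /(continuous_cvg _ (cf _)).
Unshelve. all: by end_near.
Qed.

Section expectation_of_sums.
Context {R : realType} {d} {T : measurableType d} (P : probability T R).
Context {V : zmodType} {J : choiceType}.
Variables (s0 : seq J) (Y : J -> T -> nat) (q : J -> nat -> R) (phi : J -> nat -> V).
Hypothesis mY : forall j y, measurable [set w | Y j w = y].
Hypothesis q0 : forall j y, 0 <= q j y.
Hypothesis indepY : forall (s : seq J) (y : J -> nat), uniq s -> {subset s <= s0} ->
  P (\bigcap_(j in [set` s]) [set w | Y j w = y j]) = (\prod_(j <- s) q j (y j))%:E.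

(** The statement is generalized to a cylinder fixing the labels in [t], so that induction works:
    the cylinder is split by the value of the next label, which moves from [s] to [t], and
    independence is used only for the probability of the final cylinder. *)
Lemma integral_sum_cylinder (t s : seq J) (y : J -> nat) (g : V -> \bar R) (x : V) :
  uniq (t ++ s) -> {subset t ++ s <= s0} -> (forall x, 0 <= g x)%E ->
  (\int[P]_(w in \bigcap_(j in [set` t]) [set w | Y j w = y j])
      g (x + \sum_(j <- s) phi j (Y j w))%R =
   (\prod_(j <- t) q j (y j))%R%:E *
      foldr (fun j => shift_avg (q j) (phi j)) g s x)%E.
Proof.
elim: s t y x => [|j s IH] t y x.
  rewrite cats0 => ut st g0 /=.
  under eq_integral do rewrite big_nil addr0.
  rewrite integral_cst/=; first by rewrite indepY// muleC.
  by apply: fin_bigcap_measurable => // i _; apply: mY.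
move=> uts sts g0.
set E := \bigcap_(i in _) _.
have mE : measurable E by apply: fin_bigcap_measurable => // i _; apply: mY.
have jt : j \notin t.
  by move: uts; rewrite cat_uniq => /and3P[_ /hasPn/(_ j)]; rewrite mem_head => ->.
have EE : E = \bigcup_n (E `&` [set w | Y j w = n]).
  by apply/seteqP; split => [w Ew|w [n _ []]//]; exists (Y j w).
rewrite {1}EE ge0_integral_bigcup; first last.
- by apply/trivIsetP => a b _ _ /eqP ab; rewrite -subset0 => w [[_ /= ->] [_ /=]].
- by move=> w _; apply: g0.
- apply: (@measurable_funS _ _ _ _ setT) => //.
  exact: (@measurable_sum_labels _ _ _ _ _ V J _ Y phi (fun z => g (x + z)%R) mY).
- by move=> n; apply: measurableI.
rewrite [foldr _ _ _]/= /shift_avg -nneseriesZl; last first.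
  move=> n _; rewrite mule_ge0 ?lee_fin// foldr_shift_avg_ge0//.
apply: eq_eseriesr => n _.
pose y' i := if i == j then n else y i.
have E'E : E `&` [set w | Y j w = n] =
    \bigcap_(i in [set` j :: t]) [set w | Y i w = y' i].
  apply/seteqP; split => [w [Ew Yn] i|w Ew].
    rewrite /= inE /y'; have [->//|ij /=] := eqVneq i j.
    exact: Ew.
  split; last by have := Ew j; rewrite /= mem_head /y' eqxx; apply.
  move=> i it; have := Ew i; rewrite /= inE /y'.
  by case: eqVneq => [ij|_]; [rewrite -ij it in jt|rewrite it; apply].
rewrite E'E.
under eq_integral => w wE.
  rewrite big_cons addrA.
  have -> : Y j w = n.
    move: wE; rewrite -E'E inE => -[_ /=]; exact.
  over.
rewrite IH//; last 2 first.
- by move: uts; rewrite -(cat1s j s) uniq_catCA.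
- by move=> i; rewrite /= inE mem_cat => iP; apply: sts; rewrite mem_cat inE orbCA.
rewrite big_cons {1}/y' eqxx mulrC EFinM muleA; congr (_%:E * _ * _)%E.
apply: eq_big_seq => i it; rewrite /y'; case: eqVneq => // ij.
by rewrite -ij it in jt.
Qed.

Lemma integral_sum_labels (g : V -> \bar R) : uniq s0 -> (forall x, 0 <= g x)%E ->
  (\int[P]_w g (\sum_(j <- s0) phi j (Y j w))%R =
   foldr (fun j => shift_avg (q j) (phi j)) g s0 0%R)%E.
Proof.
move=> us0 g0.
have := @integral_sum_cylinder [::] s0 (fun=> 0) g 0 us0 (fun _ => id) g0.
rewrite big_nil mul1e => <-.
rewrite set_nil bigcap_set0.
by apply: eq_integral => w _; rewrite add0r.
Qed.

End expectation_of_sums.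

(** * Box sums *)

Section box_sums.
Context {R : realType}.

Lemma cvg_sumr {T : Type} {F : set_system T} {FF : Filter F} (J : Type)
    (s : seq J) (f : J -> T -> R) (l : J -> R) :
  (forall j, f j x @[x --> F] --> l j) ->
  \sum_(j <- s) f j x @[x --> F] --> \sum_(j <- s) l j.
Proof. by move=> fl; apply: cvg_big => //; exact: add_continuous. Qed.

Lemma sum_sqr_le (J : Type) (s : seq J) (Q : pred J) (h : J -> R) :
  (forall j, Q j -> 0 <= h j) ->
  \sum_(j <- s | Q j) h j ^+ 2 <= (\sum_(j <- s | Q j) h j) ^+ 2.
Proof.
move=> h0; elim: s => [|j s IH]; first by rewrite !big_nil expr0n.
rewrite !big_cons; case: ifP => // Qj.
have S0 : 0 <= \sum_(j <- s | Q j) h j by exact: sumr_ge0.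
rewrite sqrrD -addrA lerD2l (le_trans IH)// lerDr mulrn_wge0//.
by rewrite mulr_ge0// h0.
Qed.

(* The sum over the first axis is cut into strips between consecutive
   thresholds [M x]. *)
Lemma sum_sqr_strips (h : nat -> R) (M : nat -> nat) (q : nat) :
  (forall m, (1 <= m)%N -> 0 <= h m) -> M 0 = 0 ->
  {homo M : x y / (x <= y)%N} ->
  \sum_(1 <= m < (M q).+1) h m ^+ 2 <=
  \sum_(0 <= x < q) (\sum_(1 <= m < (M x.+1).+1) h m - \sum_(1 <= m < (M x).+1) h m) ^+ 2.
Proof.
move=> h0 M0 Mh; elim: q => [|q IH]; first by rewrite M0 !big_geq.
have MM : ((M q).+1 <= (M q.+1).+1)%N by rewrite ltnS Mh.
rewrite [in leRHS]big_nat_recr// (big_cat_nat _ MM)// lerD//.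
rewrite [in leRHS](big_cat_nat _ MM)// [X in (X - _)]addrC addrK.
rewrite [X in X <= _]big_nat_cond [X in _ <= X ^+ 2]big_nat_cond; apply: sum_sqr_le => m /andP[/andP[m1 _] _].
by apply: h0; apply: leq_trans m1.
Qed.

Lemma box_sum_ge0 n (u : R * R) (a : nat -> nat -> R) :
  (forall m l, (1 <= m)%N -> (1 <= l)%N -> 0 <= a m l) -> 0 <= box_sum n u a.
Proof.
move=> a0; rewrite /box_sum big_nat_cond sumr_ge0// => m /andP[/andP[m1 _] _].
by rewrite big_nat_cond sumr_ge0// => l /andP[/andP[l1 _] _]; apply: a0.
Qed.

(** For each [m], the sum of the squares over [l] is at most the square of the sum over [l]; these
    sums are then grouped into strips of width [s]. *)
Lemma box_sum_sqr_strips n (s t : R) (a : nat -> nat -> R) (q : nat) :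
  0 <= s -> (forall m l, (1 <= m)%N -> (1 <= l)%N -> 0 <= a m l) ->
  box_sum n (s * q%:R, t) (fun m l => a m l ^+ 2) <=
  \sum_(0 <= x < q)
    (box_sum n (s * x.+1%:R, t) a - box_sum n (s * x%:R, t) a) ^+ 2.
Proof.
move=> s0 a0.
pose h m := \sum_(1 <= l < (Num.truncn (n%:R * t)).+1) a m l.
pose M x := Num.truncn (n%:R * (s * x%:R)).
have h0 m : (1 <= m)%N -> 0 <= h m.
  by move=> m1; rewrite /h big_nat_cond sumr_ge0// => l /andP[/andP[l1 _] _]; apply: a0.
have M0 : M 0 = 0 by rewrite /M !mulr0 truncn0.
have Mh : {homo M : x y / (x <= y)%N}.
  by move=> x y xy; apply: le_truncn; rewrite !ler_wpM2l// ler_nat.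
apply: le_trans (sum_sqr_strips q h0 M0 Mh).
rewrite /box_sum [leLHS]big_nat_cond [leRHS]big_nat_cond ler_sum// => m /andP[/andP[m1 _] _].
rewrite /h [X in X <= _]big_nat_cond [X in _ <= X ^+ 2]big_nat_cond; apply: sum_sqr_le => l /andP[/andP[l1 _] _].
exact: a0.
Qed.

(** With [q.+1] strips of equal width, each has limit mass [c * s * t / q.+1]. The squares of these
    masses add up to [(c * s * t) ^+ 2 / q.+1], which is below [e] once [q] is large. *)
Lemma box_sum_sqr_cvg0 (p : nat -> nat -> nat -> R) (c s t : R) :
  (forall n m l, (1 <= n)%N -> (1 <= m)%N -> (1 <= l)%N -> 0 <= p n m l) ->
  (forall s t, 0 <= s -> 0 <= t -> box_sum n (s, t) (p n) @[n --> \oo] --> c * s * t) ->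
  0 <= s -> 0 <= t ->
  box_sum n (s, t) (fun m l => p n m l ^+ 2) @[n --> \oo] --> 0.
Proof.
move=> p0 pcvg s0 t0; apply/cvgrPdist_lt => e e0.
pose D := (c * s * t) ^+ 2.
have [q] : exists q : nat, D / q.+1%:R < e.
  exists (Num.truncn (D / e)); rewrite ltr_pdivrMr ?ltr0n// mulrC -ltr_pdivrMr//.
  have := truncnS_gt (D / e); exact.
set s' := s / q.+1%:R => qe.
have s'0 : 0 <= s' by rewrite divr_ge0.
have sE : s = s' * q.+1%:R by rewrite divfK// pnatr_eq0.
have : \sum_(0 <= x < q.+1)
    (box_sum n (s' * x.+1%:R, t) (p n) - box_sum n (s' * x%:R, t) (p n)) ^+ 2
    @[n --> \oo] --> D / q.+1%:R.
  have -> : D / q.+1%:R = \sum_(0 <= x < q.+1)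
      ((c * (s' * x.+1%:R) * t) - (c * (s' * x%:R) * t)) ^+ 2.
    transitivity (\sum_(0 <= x < q.+1) (c * s' * t) ^+ 2).
      rewrite sumr_const_nat subn0 /D sE -[in RHS]mulr_natl; field.
      by rewrite addrC natr1 pnatr_eq0.
    by apply: eq_bigr => x _; rewrite -natr1; congr (_ ^+ 2); ring.
  apply: (@cvg_sumr _ _ _ _ _ (fun x n => (box_sum n (s' * x.+1%:R, t) (p n) -
    box_sum n (s' * x%:R, t) (p n)) ^+ 2)) => x.
  by apply: cvgM; apply: cvgB; apply: pcvg => //; rewrite mulr_ge0.
move=> /cvgr_lt/(_ _ qe) H; near=> n.
have pn0 m l : (1 <= m)%N -> (1 <= l)%N -> 0 <= p n m l.
  by apply: p0; near: n; exact: nbhs_infty_gt.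
rewrite sub0r normrN ger0_norm; last first.
  by apply: box_sum_ge0 => m l _ _; apply: sqr_ge0.
rewrite sE; apply: le_lt_trans (box_sum_sqr_strips _ _ _ s'0 pn0) _.
by near: n.
Unshelve. all: by end_near.
Qed.

(** * Regions between consecutive boxes of a chain *)

Section regions.
Variables (r : nat) (u : 'I_r.+1 -> R * R) (n : nat).
Hypothesis u0 : forall a, quadrant (u a).
Hypothesis uchain : forall a b : 'I_r.+1, (a <= b)%N -> u a ⪯ u b.

(** Putting the origin before the first point makes every region, the first included, a difference
    of two boxes. *)
Definition prev_pt (a : 'I_r.+1) : R * R :=
  if a == 0 :> nat then (0, 0) else u (inord a.-1).

Lemma prev_pt_quadrant a : quadrant (prev_pt a).
Proof. by rewrite /prev_pt; case: ifP => // _; split => /=. Qed.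

Lemma prev_pt_le (a b : 'I_r.+1) : (a <= b)%N -> prev_pt a ⪯ u b.
Proof.
move=> ab; rewrite /prev_pt; case: eqP => [_|/eqP a0]; first by split; case: (u0 b).
have ar : (a.-1 < r.+1)%N by rewrite (leq_ltn_trans (leq_pred _)).
by apply: uchain; rewrite inordK// (leq_trans (leq_pred _)).
Qed.

Lemma le_prev_pt (a b : 'I_r.+1) : (a < b)%N -> u a ⪯ prev_pt b.
Proof.
move=> ab; rewrite /prev_pt; case: eqP => [b0|_]; first by rewrite b0 in ab.
have br : (b.-1 < r.+1)%N by rewrite (leq_ltn_trans (leq_pred _)).
by apply: uchain; rewrite inordK// -ltnS prednK// (leq_ltn_trans _ ab).
Qed.

(* The cell [(m, l)] of the statement has index [(m - 1, l - 1)]. *)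
Definition in_box (a : 'I_r.+1) (c : nat * nat) : bool :=
  (c.1 < Num.truncn (n%:R * (u a).1))%N && (c.2 < Num.truncn (n%:R * (u a).2))%N.

Definition cells : seq (nat * nat) :=
  [seq (m, l) | m <- iota 0 (Num.truncn (n%:R * (u ord_max).1)),
                l <- iota 0 (Num.truncn (n%:R * (u ord_max).2))].

(** The first box of the chain that contains the cell. The default [ord_max] satisfies the predicate
    for [c] in [cells], so the minimum is a genuine one there. *)
Definition region (c : nat * nat) : 'I_r.+1 := [arg min_(a < ord_max | in_box a c) a].

Lemma cells_uniq : uniq cells.
Proof. by apply: allpairs_uniq; rewrite ?iota_uniq// => -[? ?] [? ?]. Qed.

Lemma in_box_max c : c \in cells -> in_box ord_max c.
Proof.
by move=> /allpairsP[[m l] [/=]]; rewrite !mem_iota /in_box => /= m1 l1 ->; rewrite m1.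
Qed.

Lemma in_box_mono (a b : 'I_r.+1) c : (a <= b)%N -> in_box a c -> in_box b c.
Proof.
move=> ab /andP[ca cb]; have [h1 h2] := uchain ab.
by apply/andP; split; [apply: leq_trans ca _|apply: leq_trans cb _];
  apply: le_truncn; rewrite ler_wpM2l.
Qed.

Lemma in_boxE a c : c \in cells -> in_box a c = (region c <= a)%N.
Proof.
move=> /in_box_max cm; rewrite /region; case: arg_minnP => // b bc bmin.
by apply/idP/idP => [/bmin//|ba]; apply: in_box_mono bc.
Qed.

Lemma box_sum_cells a (h : nat -> nat -> R) :
  box_sum n (u a) h = \sum_(c <- cells | (region c <= a)%N) h c.1.+1 c.2.+1.
Proof.
have -> : \sum_(c <- cells | (region c <= a)%N) h c.1.+1 c.2.+1 =
    \sum_(c <- cells | in_box a c) h c.1.+1 c.2.+1.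
  rewrite big_seq_cond [RHS]big_seq_cond; apply: eq_bigl => c.
  by case: (boolP (c \in cells)) => //= cc; rewrite in_boxE.
rewrite /box_sum /cells [RHS]big_mkcond big_allpairs/=.
have [am1 am2] := uchain (leq_ord a : (a <= @ord_max r)%N).
have le1 : (Num.truncn (n%:R * (u a).1) <= Num.truncn (n%:R * (u ord_max).1))%N.
  by apply: le_truncn; rewrite ler_wpM2l.
have le2 : (Num.truncn (n%:R * (u a).2) <= Num.truncn (n%:R * (u ord_max).2))%N.
  by apply: le_truncn; rewrite ler_wpM2l.
set M := Num.truncn _ in le1 *; set L := Num.truncn _ in le2 *.
rewrite big_add1/= (big_nat_widen _ _ _ _ _ le1) big_mkcond/=.
rewrite /index_iota subn0; apply: eq_bigr => m _; rewrite /in_box -/M -/L/=.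
case: ifP => _ /=; last by rewrite big1.
by rewrite big_add1/= (big_nat_widen _ _ _ _ _ le2) big_mkcond/= /index_iota subn0.
Qed.

Lemma box_sum_region a (h : nat -> nat -> R) :
  \sum_(c <- cells | region c == a) h c.1.+1 c.2.+1 =
  box_sum n (u a) h - box_sum n (prev_pt a) h.
Proof.
rewrite /prev_pt; case: eqP => [a0|/eqP a0].
  rewrite {2}/box_sum/= mulr0 truncn0 big_geq// subr0 box_sum_cells.
  by apply: eq_bigl => c; rewrite a0 leqn0 -val_eqE/= a0.
rewrite !box_sum_cells; apply/esym/eqP; rewrite subr_eq eq_sym; apply/eqP.
rewrite [RHS](bigID (fun c => region c == a))/=; congr (_ + _).
  by apply: eq_bigl => c; case: eqP => [->|//]; rewrite ?leqnn ?andbF.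
apply: eq_bigl => c; rewrite inordK; last by rewrite (leq_ltn_trans (leq_pred _)).
by rewrite -ltnS prednK ?lt0n// ltn_neqAle andbC.
Qed.

End regions.

End box_sums.

(** * Marked cells *)

Lemma independent_seq {d} {T : measurableType d} {R : realType} (P : probability T R)
    {I : choiceType} (D : set I) (F : I -> set (set T)) (s : seq I) (B : I -> set T) :
  independent_classes P D F -> uniq s -> (forall i, i \in s -> D i) ->
  (forall i, i \in s -> F i (B i)) ->
  P (\bigcap_(i in [set` s]) B i) = (\prod_(i <- s) P (B i))%E.
Proof.
move=> ind us sD sF.
have mem i : (i \in seq_fset tt s) = (i \in s) by rewrite seq_fsetE.
have := ind (seq_fset tt s) B.
rewrite (perm_big _ (uniq_perm (fset_uniq _) us mem)).
have -> : [set` seq_fset tt s] = [set` s].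
  by apply/seteqP; split => i H; [exact: etrans (esym (mem i)) H|exact: etrans (mem i) H].
move=> -> //.
- by move=> i; rewrite mem; apply: sD.
- by move=> i; rewrite mem; apply: sF.
Qed.

Lemma sum_prob_labels {d} {T : measurableType d} {R : realType}
    (P : probability T R) (Y : T -> nat) :
  (forall y, measurable [set w | Y w = y]) ->
  (\sum_(0 <= y <oo) P [set w | Y w = y] = 1)%E.
Proof.
move=> mY; rewrite -(@probability_setT _ _ _ P).
have -> : [set: T] = \bigcup_y [set w | Y w = y].
  by apply/seteqP; split => // w _; exists (Y w).
rewrite measure_bigcup//; last first.
  by apply/trivIsetP => a b _ _ /eqP ab; rewrite -subset0 => w [/= -> ].
by apply: eq_eseriesl => y; rewrite in_setT.
Qed.

Lemma fine_prob {d} {T : measurableType d} {R : realType} (P : probability T R) (A : set T) :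
  measurable A -> (fine (P A))%:E = P A.
Proof. by move=> mA; rewrite fineK// fin_num_measure. Qed.

Lemma measurable_index {R : realType} (L : seq (R * R)) (y : nat) :
  measurable [set z | index z L = y].
Proof.
have m1 (a : R * R) : measurable [set a].
  have -> : [set a] = [set a.1] `*` [set a.2].
    by apply/seteqP; split => [z ->//|[z1 z2] [/= -> ->]]; case: a.
  by apply: measurableX.
elim: L y => [|a L IH] y.
  case: y => [|y].
    by rewrite (_ : [set _ | _] = setT)//; apply/seteqP; split.
  by rewrite (_ : [set _ | _] = set0)//; apply/seteqP; split.
case: y => [|y].
  rewrite (_ : [set _ | _] = [set a])//; apply/seteqP; split => z /=.
    by case: eqVneq.
  by move=> ->; rewrite eqxx.
rewrite (_ : [set _ | _] = ~` [set a] `&` [set z | index z L = y]).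
  by apply: measurableI => //; apply: measurableC.
apply/seteqP; split => z /=.
  by case: eqVneq => // az [<-]; split => // za; rewrite za eqxx in az.
by case: eqVneq => [->[]//|_ [_ <-]].
Qed.

Section marked_labels.
Context {R : realType} (k : nat) (I : {fset R}).
Hypothesis I0 : 0 \notin I.
Local Notation B := (I * 'I_k)%type.

Definition mark_pt (b : B) : R * R := (val b.1, b.2.+1%:R).
Definition mark_pts : seq (R * R) := map mark_pt (enum {: B}).

Definition mark_weight (b : B) : R := val b.1 * b.2.+1%:R.

(* The label [#|{: B}|] stands for every value outside [mark_pts], and has weight 0. *)
Definition label_weight (y : nat) : R := let z := nth (0, 0) mark_pts y in z.1 * z.2.

Lemma mark_pt_inj : injective mark_pt.
Proof.
move=> [i j] [i' j'] [/val_inj -> /eqP]; rewrite eqr_nat => /eqP [] /val_inj ->//.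
Qed.

Lemma size_mark_pts : size mark_pts = #|{: B}|.
Proof. by rewrite size_map -cardE. Qed.

Lemma nth_mark_pts b : nth (0, 0) mark_pts (enum_rank b) = mark_pt b.
Proof. by rewrite (nth_map b) ?nth_enum_rank// -cardE. Qed.

Lemma index_mark_pts b z : (index z mark_pts = enum_rank b) <-> z = mark_pt b.
Proof.
split=> [zb|->].
  rewrite -nth_mark_pts -zb nth_index// -index_mem zb size_mark_pts.
  exact: ltn_ord.
rewrite -nth_mark_pts index_uniq ?size_mark_pts//.
by rewrite map_inj_uniq ?enum_uniq//; exact: mark_pt_inj.
Qed.

Lemma label_weight_rank b : label_weight (enum_rank b) = mark_weight b.
Proof. by rewrite /label_weight nth_mark_pts. Qed.

Lemma label_weight_out y : (#|{: B}| <= y)%N -> label_weight y = 0.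
Proof. by move=> By; rewrite /label_weight nth_default ?size_mark_pts//= mul0r. Qed.

Lemma mark_weight_neq0 b : mark_weight b != 0.
Proof.
rewrite mulf_neq0 ?pnatr_eq0//; apply: contraNneq I0 => <-; exact: valP.
Qed.

Context {d} {T : measurableType d} (P : probability T R) (X : {RV P >-> (R * R)%type}).
Variable p : B -> R.
Hypothesis Xp : forall b, P [set w | X w = mark_pt b] = (p b)%:E.
Hypothesis Xzero : P [set w | [\/ exists2 i, i \in I & X w = (i, 0),
                    exists2 j, (1 <= j <= k)%N & X w = (0, j%:R)
                  | X w = (0, 0)]] = (1 - \sum_b p b)%:E.

(** A variable with values in [nat], the form that the averaging operators handle; all vectors that
    are not marks share one label. *)
Definition label (w : T) : nat := index (X w) mark_pts.
Definition label_law (y : nat) : R := fine (P [set w | label w = y]).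

Lemma measurable_label y : measurable [set w | label w = y].
Proof.
have := @measurable_funPT _ _ _ _ X measurableT _ (measurable_index mark_pts y).
by rewrite setTI.
Qed.

Lemma label_law_ge0 y : 0 <= label_law y.
Proof. by rewrite fine_ge0. Qed.

Lemma label_lawE y : P [set w | label w = y] = (label_law y)%:E.
Proof. by rewrite /label_law fine_prob//; exact: measurable_label. Qed.

Lemma label_law_sum : (\sum_(0 <= y <oo) (label_law y)%:E = 1)%E.
Proof.
rewrite -(sum_prob_labels P measurable_label).
by apply: eq_eseriesr => y _; rewrite label_lawE.
Qed.

Lemma label_law_rank b : label_law (enum_rank b) = p b.
Proof.
apply: EFin_inj; rewrite -label_lawE -Xp; congr (P _).
by apply/seteqP; split => w /index_mark_pts.
Qed.

Lemma label_law_gt y : (#|{: B}|.+1 <= y)%N -> label_law y = 0.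
Proof.
move=> By; rewrite /label_law (_ : [set _ | _] = set0) ?measure0//.
apply/seteqP; split => // w /= wy; have := index_size (X w) mark_pts.
by rewrite -/(label w) wy size_mark_pts leqNgt By.
Qed.

Lemma sum_label_law (U : nmodType) (F : nat -> U) :
  \sum_(0 <= y < #|{: B}|) F y = \sum_(b : B) F (enum_rank b).
Proof.
rewrite big_mkord (reindex (@enum_rank {: B}))//=.
exact: onW_bij (@enum_rank_bij {: B}).
Qed.

Lemma label_law_out : label_law #|{: B}| = 1 - \sum_b p b.
Proof.
have := label_law_sum; rewrite (nneseries_split 0 #|{: B}|.+1); last first.
  by move=> y _; rewrite lee_fin label_law_ge0.
rewrite add0n [X in (_ + X)%E]eseries0 ?adde0; last first.
  by move=> y By _; rewrite label_law_gt.
rewrite sumEFin big_nat_recr//= sum_label_law => -[].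
under eq_bigr do rewrite label_law_rank.
by move=> <-; rewrite addrAC subrr add0r.
Qed.

(** This is the form of a cell operator required by [bernoulli_chain]: the label [#|{: B}|] carries
    the remaining mass and does not move the argument. *)
Lemma shift_avg_label (V : lmodType R) (e : V) (g : V -> \bar R) (x : V) :
  (forall x, 0 <= g x)%E ->
  (shift_avg label_law (fun y => label_weight y *: e) g x =
   (1 - \sum_b p b)%R%:E * g x + \sum_b (p b)%:E * g (x + mark_weight b *: e)%R)%E.
Proof.
move=> g0; rewrite (@shift_avg_fin _ _ _ _ _ _ #|{: B}|.+1)//; last 2 first.
- exact: label_law_ge0.
- exact: label_law_gt.
rewrite big_nat_recr//= label_law_out label_weight_out// scale0r addr0 addeC.
congr (_ + _)%E; rewrite sum_label_law; apply: eq_bigr => b _.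
by rewrite label_law_rank label_weight_rank.
Qed.

(** Where the label is a mark, the equality is exact. The event [W], on which the product is 0, is
    contained in the event [A0] of the label [#|{: B}|], because marks have nonzero weight. Both
    have probability [1 - \sum_b p b], so their difference is a null set. *)
Lemma prod_label_ae : {ae P, forall w, (X w).1 * (X w).2 = label_weight (label w)}.
Proof.
(* Listing the values without a mark makes their event measurable through [index]. *)
pose L0 : seq (R * R) := [seq (i, 0) | i <- I] ++ [seq (0, j%:R) | j <- iota 1 k] ++ [:: (0, 0)].
have L0P z : z \in L0 <-> [\/ exists2 i, i \in I & z = (i, 0),
    exists2 j, (1 <= j <= k)%N & z = (0, j%:R) | z = (0, 0)].
  rewrite /L0 !mem_cat inE; split.
    case/or3P => [/mapP[i iI ->]|/mapP[j]|/eqP ->].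
    - by apply: Or31; exists i.
    - by rewrite mem_iota add1n ltnS => jk ->; apply: Or32; exists j.
    - exact: Or33.
  case=> [[i iI ->]|[j jk ->]|->].
  - by apply/or3P/Or31/mapP; exists i.
  - by apply/or3P/Or32/mapP; exists j => //; rewrite mem_iota add1n ltnS.
  - by apply/or3P/Or33.
have := Xzero; set W := [set w | _] => Wzero.
have WE : W = X @^-1` (~` [set z | index z L0 = size L0]).
  apply/seteqP; split => w /=.
    by move/L0P; rewrite -index_mem => h h'; rewrite h' ltnn in h.
  move=> h; apply/L0P; rewrite -index_mem ltn_neqAle index_size andbT.
  exact/eqP.
have mW : measurable W.
  rewrite WE -[X in measurable X]setTI.
  apply: (@measurable_funPT _ _ _ _ X) => //.
  by apply: measurableC; exact: measurable_index.
have W0 w : W w -> (X w).1 * (X w).2 = 0.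
  by move=> [[i _ ->]|[j _ ->]|->]/=; rewrite ?mulr0 ?mul0r.
have labelW w : (label w < #|{: B}|)%N -> (X w).1 * (X w).2 = label_weight (label w).
  move=> lB; rewrite /label_weight nth_index// -index_mem size_mark_pts.
  exact: lB.
pose A0 := [set w | label w = #|{: B}|].
have mA0 : measurable A0 by exact: measurable_label.
have WA : W `<=` A0.
  move=> w Ww; apply/eqP; rewrite eqn_leq -{1}size_mark_pts index_size/= leqNgt.
  apply/negP => lB; have := W0 w Ww; rewrite labelW//.
  have -> : label w = enum_rank (enum_val (Ordinal lB)) by rewrite enum_valK.
  by rewrite label_weight_rank => /eqP; apply/negP; exact: mark_weight_neq0.
exists (A0 `\` W); split.
- exact: measurableD.
- rewrite measureD//; last by rewrite (le_lt_trans (probability_le1 P mA0))// ltry.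
  rewrite (setIidr WA) -[LHS]/(P A0 - P W)%E Wzero label_lawE label_law_out.
  by rewrite -EFinB subrr.
- move=> w /= nw.
  have lB : label w = #|{: B}|.
    apply/eqP; rewrite eqn_leq -{1}size_mark_pts index_size/= leqNgt.
    by apply/negP => lB; apply: nw; apply: labelW.
  by split => // Ww; apply: nw; rewrite W0// label_weight_out// lB.
Qed.

End marked_labels.

Lemma sum_pair_fst (U : nmodType) (A1 A2 : finType) (a : A1) (F : A1 * A2 -> U) :
  \sum_(x : A1 * A2) (if a == x.1 then F x else 0) = \sum_b F (a, b).
Proof.
transitivity (\sum_a' \sum_b if a == a' then F (a', b) else 0).
  by rewrite pair_big/=; apply: eq_bigr => -[].
rewrite (bigD1 a)//= [X in _ + X]big1 ?addr0.
  by apply: eq_bigr => b _; rewrite eqxx.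
by move=> a'; rewrite eq_sym => /negbTE aa'; rewrite big1// => b _; rewrite aa'.
Qed.

(** * Poisson bound for an array of marks *)

Section marked_array.
Context {R : realType} {V : lmodType R} (k : nat) (I : {fset R}) {A0 : finType}.
Local Notation B := (I * 'I_k)%type.

(** A mark in a region moves the sum along the direction of that region, by the product of the
    coordinates of the mark. *)
Definition shift_dir (e : A0 -> V) (a : A0 * B) : V := mark_weight a.2 *: e a.1.

Lemma array_upper {d} {T : measurableType d} (P : probability T R)
    (J : choiceType) (s : seq J) (X : J -> {RV P >-> (R * R)%type}) (p : J -> B -> R)
    (rho : J -> A0) (e : A0 -> V) (C : R) (g : V -> \bar R) :
  uniq s ->
  (forall c b, 0 <= p c b) -> (forall c, \sum_b p c b <= 1) ->
  (forall (t : seq J) (D : J -> set (R * R)), uniq t ->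
     (forall c, measurable (D c)) ->
     P (\bigcap_(c in [set` t]) X c @^-1` D c) = (\prod_(c <- t) P (X c @^-1` D c))%E) ->
  (forall c b, P [set w | X c w = mark_pt b] = (p c b)%:E) ->
  0 <= C -> (forall x, 0 <= g x)%E -> (forall x, g x <= C%:E)%E ->
  (\int[P]_w g (\sum_(c <- s) label_weight k I (label k I (X c) w) *: e (rho c))%R <=
   multi_pois (shift_dir e)
     (fun a => \sum_(c <- s | rho c == a.1) p c a.2)%R g 0%R +
   (C * \sum_(c <- s) (\sum_b p c b) ^+ 2)%:E)%E.
Proof.
move=> us p0 p1 ind Xp C0 g0 gC.
rewrite (@integral_sum_labels _ _ _ P V J s (fun c => label k I (X c))
  (fun c => label_law k I (X c)) (fun c y => label_weight k I y *: e (rho c))) //;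
  last 3 first.
- by move=> c y; exact: measurable_label.
- by move=> c y; exact: label_law_ge0.
- move=> t y ut _.
  have := ind t (fun c => [set z | index z (mark_pts k I) = y c]) ut
    (fun c => measurable_index _ _).
  move=> ->; rewrite -prodEFin; apply: eq_bigr => c _.
  by rewrite -label_lawE.
(* A cell places its rates on the directions of its own region only. *)
pose mu_ c (a : A0 * B) := if rho c == a.1 then p c a.2 else 0.
have mu_sum c : \sum_(a : A0 * B) mu_ c a = \sum_b p c b.
  exact: (sum_pair_fst _ (fun a => p c a.2)).
have := @bernoulli_chain R V _ (shift_dir e) J s
  (fun c => label_law k I (X c)) (fun c y => label_weight k I y *: e (rho c)) mu_ C g.
have -> : (fun a : A0 * B => \sum_(c <- s | rho c == a.1) p c a.2) =
    (fun a => \sum_(c <- s) mu_ c a).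
  by apply/funext => a; rewrite big_mkcond.
have -> : \sum_(c <- s) (\sum_b p c b) ^+ 2 = \sum_(c <- s) (\sum_a mu_ c a) ^+ 2.
  by apply: eq_bigr => c _; rewrite mu_sum.
apply => //.
- by move=> c y; exact: label_law_ge0.
- by move=> c; exact: label_law_sum.
- by move=> c a; rewrite /mu_; case: ifP.
- by move=> c; rewrite mu_sum.
- move=> c h h0 x; rewrite (shift_avg_label (Xp c) _ _ h0) mu_sum.
  congr (_ + _)%E; rewrite -(sum_pair_fst _ (fun a => (p c a.2)%:E *
    h (x + shift_dir e a)%R)%E).
  by apply: eq_bigr => a _; rewrite /mu_; case: ifP => // _; rewrite mul0e.
Qed.

End marked_array.

(** * The Skellam field *)

Lemma measurable_truncn_fiber {R : realType} (y : nat) :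
  measurable [set x : R | Num.truncn x = y].
Proof.
case: y => [|y].
  rewrite (_ : [set _ | _] = [set` `]-oo, 1[%R]); first exact: measurable_itv.
  apply/seteqP; split => x /=; rewrite in_itv/= ltNge.
    by move/truncn0Pn.
  by move=> h; apply/truncn0Pn.
rewrite (_ : [set _ | _] = [set` `[y.+1%:R, y.+2%:R[%R]); first exact: measurable_itv.
apply/seteqP; split => x /=; rewrite in_itv/=; last exact: truncn_def.
move=> xy; have x0 : 0 <= x.
  have : (0 < Num.truncn x)%N by rewrite xy.
  by rewrite truncn_gt0; apply: le_trans.
by rewrite -xy truncn_itv.
Qed.

Lemma measurable_natr_comp {R : realType} {d} {T : measurableType d} (N : T -> nat) :
  measurable_fun setT N -> measurable_fun setT (fun w => (N w)%:R : R).
Proof.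
move=> mN; apply: (@measurableT_comp _ _ _ _ _ _ (fun n : nat => n%:R : R)) mN.
by move=> _ D _; rewrite setTI.
Qed.

Lemma measurable_increment {R : realType} {d} {T : measurableType d}
    (M : R * R -> T -> nat) (u v : R * R) :
  (forall z, quadrant z -> measurable_fun setT (M z)) ->
  quadrant u -> quadrant v ->
  measurable_fun setT (increment (fun z w => (M z w)%:R : R) u v).
Proof.
move=> mM [u1 u2] [v1 v2].
have mMR z (qz : quadrant z) := @measurable_natr_comp R _ _ _ (mM z qz).
rewrite /increment; apply: measurable_funD; last exact: mMR.
by apply: measurable_funB; [apply: measurable_funB|]; apply: mMR.
Qed.

Section rectangle_counts.
Context {R : realType} {d} {T : measurableType d} (P : probability T R).
Context (k : nat) (lambda : nat -> R) (M : R * R -> T -> nat).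
Hypothesis lambda0 : forall j, (1 <= j <= k)%N -> 0 < lambda j.
Hypothesis HM : is_GPRF P k lambda M.

(** Increments are natural numbers only almost surely; truncation yields a count in [nat] at every
    [w]. *)
Definition rect_count (u v : R * R) (w : T) : nat :=
  Num.truncn (increment (fun z w => (M z w)%:R : R) u v w).

Definition rect_rate (u v : R * R) (j : 'I_k) : R :=
  lambda j.+1 * (v.1 - u.1) * (v.2 - u.2).

Lemma rect_rate_ge0 u v : u ⪯ v -> forall j, 0 <= rect_rate u v j.
Proof.
by move=> [uv1 uv2] j; rewrite /rect_rate !mulr_ge0 ?subr_ge0// ltW// lambda0/=.
Qed.

Lemma measurable_rect_count u v y : quadrant u -> quadrant v ->
  measurable [set w | rect_count u v w = y].
Proof.
move=> qu qv.
have := measurable_increment (GPRF_measurable HM) qu qv measurableT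
  (measurable_truncn_fiber y).
by rewrite setTI.
Qed.

(** The prescribed probabilities of the natural values sum to 1, which leaves no mass for other
    values. *)
Lemma increment_nat_ae u v : quadrant u -> quadrant v -> u ⪯ v ->
  {ae P, forall w, increment (fun z w => (M z w)%:R : R) u v w = (rect_count u v w)%:R}.
Proof.
move=> qu qv uv.
pose E n := [set w | increment (fun z w => (M z w)%:R : R) u v w = n%:R].
have mE n : measurable (E n).
  have := measurable_increment (GPRF_measurable HM) qu qv measurableT
    (measurable_set1 (n%:R : R)).
  by rewrite setTI.
have mU : measurable (\bigcup_n E n) by apply: bigcupT_measurable.
have PE : P (\bigcup_n E n) = 1%E.
  rewrite measure_bigcup//; last first.
    apply/trivIsetP => a b _ _ /eqP ab; rewrite -subset0 => w [Ea Eb].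
    have : a%:R = b%:R :> R by exact: etrans (esym Ea) Eb.
    by move/eqP; rewrite eqr_nat => /eqP.
  rewrite -(theta_weight_sum (rect_rate_ge0 uv)).
  rewrite (@eq_eseriesl _ _ xpredT); last by move=> y; rewrite in_setT.
  by apply: eq_eseriesr => n _; rewrite [LHS](GPRF_law HM _ qu uv).
exists (~` \bigcup_n E n); split.
- exact: measurableC.
- by rewrite probability_setC// PE subee.
- move=> w nw [n _ En]; apply: nw.
  have {}En : increment (fun z w => (M z w)%:R : R) u v w = n%:R by exact: En.
  by apply: (etrans En); rewrite /rect_count En natrK.
Qed.

Lemma rect_count_law u v y : quadrant u -> quadrant v -> u ⪯ v ->
  P [set w | rect_count u v w = y] = (theta_weight (rect_rate u v) y)%:E.
Proof.
move=> qu qv uv; rewrite -[RHS](GPRF_law HM y qu uv).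
have mE : measurable [set w | increment (fun z w => (M z w)%:R : R) u v w = y%:R].
  have := measurable_increment (GPRF_measurable HM) qu qv measurableT
    (measurable_set1 (y%:R : R)).
  by rewrite setTI.
have mA := measurable_rect_count y qu qv.
have [N [mN PN subN]] := increment_nat_ae qu qv uv.
apply/eqP; rewrite eq_le; apply/andP; split.
  (* The truncation can equal [y] also where the increment is not a natural number; such points lie
     in the null set [N]. *)
  apply: (@le_trans _ _ (P ([set w | increment (fun z w => (M z w)%:R : R) u v w =
      y%:R] `|` N))).
    apply: le_measure; rewrite ?inE//; first exact: measurableU.
    move=> w wy; have [Nw|nNw] := pselect (N w); [by right|left].
    by apply: contrapT => h; apply/nNw/subN => /= iw; apply: h; rewrite /= iw wy.
  by apply: (le_trans (measureU2 _ _ _)) => //; rewrite -[X in (_ + X)%E]/(P N) PN adde0.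
apply: le_measure; rewrite ?inE// => w wy; rewrite /= /rect_count.
have -> : increment (fun z w => (M z w)%:R : R) u v w = y%:R by exact: wy.
exact: natrK.
Qed.

Lemma rect_count_independent (K : finType) (lo hi : K -> R * R) (t : seq K)
    (y : K -> nat) :
  (forall z, quadrant (lo z)) -> (forall z, quadrant (hi z)) ->
  (forall z, lo z ⪯ hi z) ->
  trivIset setT (fun z => rect (lo z) (hi z)) -> uniq t ->
  P (\bigcap_(z in [set` t]) [set w | rect_count (lo z) (hi z) w = y z]) =
  (\prod_(z <- t) theta_weight (rect_rate (lo z) (hi z)) (y z))%:E.
Proof.
move=> qlo qhi lohi triv ut.
pose lo' (n : 'I_#|K|) := lo (enum_val n); pose hi' (n : 'I_#|K|) := hi (enum_val n).
have triv' : trivIset [set: 'I_#|K|] (fun n => rect (lo' n) (hi' n)).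
  move=> m n _ _ mn; apply: enum_val_inj; exact: triv.
have ind := GPRF_independent HM (fun n => qlo (enum_val n))
  (fun n => lohi (enum_val n)) triv'.
pose s := map enum_rank t.
pose D (n : 'I_#|K|) : set T :=
  [set w | rect_count (lo' n) (hi' n) w = y (enum_val n)].
have us : uniq s by rewrite map_inj_uniq//; exact: enum_rank_inj.
have := @independent_seq _ _ _ P _ _ _ s D ind us (fun _ _ => Logic.I).
have -> : \bigcap_(n in [set` s]) D n =
    \bigcap_(z in [set` t]) [set w | rect_count (lo z) (hi z) w = y z].
  apply/seteqP; split => w Dw z /= zt.
    have := Dw (enum_rank z); rewrite /D /lo' /hi' /= enum_rankK; apply.
    exact: map_f.
  by move: zt => /mapP[z' z't ->]; rewrite /D /lo' /hi' /= enum_rankK; apply: Dw.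
move=> ->; last first.
  move=> n _; exists [set x | Num.truncn x = y (enum_val n)].
    exact: measurable_truncn_fiber.
  by rewrite setTI.
rewrite /s big_map -prodEFin; apply: eq_bigr => z _.
by rewrite /D /lo' /hi' enum_rankK rect_count_law.
Qed.

(** The measurability of increments is reused with the sigma-algebra generated by [M] in place of
    the ambient one, since independence of the processes is stated for these sigma-algebras. *)
Lemma rect_count_process_sigma u v y : quadrant u -> quadrant v ->
  process_sigma quadrant M [set w | rect_count u v w = y].
Proof.
move=> qu qv.
set G := \bigcup_(z in quadrant) preimage_set_system [set: T] (M z) measurable.
have mM z : quadrant z ->
    measurable_fun [set: g_sigma_algebraType G] (M z : g_sigma_algebraType G -> nat).
  move=> qz _ D mD; apply: sub_gen_smallest; exists z => //.
  by exists D.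
have := @measurable_increment _ _ (g_sigma_algebraType G) M u v mM qu qv measurableT _
  (measurable_truncn_fiber y).
by rewrite setTI.
Qed.

End rectangle_counts.

(** * The Skellam row as a sum of independent counts *)

Section skellam.
Context {R : realType} (r : nat) (u : 'I_r.+1 -> R * R).
Hypothesis u0 : forall a, quadrant (u a).
Hypothesis uchain : forall a b : 'I_r.+1, (a <= b)%N -> u a ⪯ u b.

Lemma sum_prev_pt (U : zmodType) (F : R * R -> U) (b : 'I_r.+1) :
  \sum_(a : 'I_r.+1 | (a <= b)%N) (F (u a) - F (prev_pt u a)) = F (u b) - F (0, 0).
Proof.
move: {2}(nat_of_ord b) (erefl (nat_of_ord b)) => n; elim: n b => [|n IH] b bn.
  rewrite (big_pred1 b) ?/prev_pt ?bn// => a.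
  by rewrite leqn0 /= -val_eqE/= bn.
have nr : (n < r.+1)%N by rewrite ltnW// -bn.
have pb : prev_pt u b = u (inord n) by rewrite /prev_pt bn.
rewrite (bigD1 b)//= pb (eq_bigl (fun a : 'I_r.+1 => (a <= @inord r n)%N)).
  by rewrite IH ?inordK// addrA subrK.
by move=> a; rewrite inordK// -val_eqE/= bn andbC -ltn_neqAle ltnS.
Qed.

(** Cuts an L-shaped region in two: [true] is the part above the height of the previous point, over
    the full width, and [false] the part below that height, to the right of the previous point. *)
Definition rect_lo (z : 'I_r.+1 * bool) : R * R :=
  if z.2 then (0, (prev_pt u z.1).2) else ((prev_pt u z.1).1, 0).

Definition rect_hi (z : 'I_r.+1 * bool) : R * R :=
  if z.2 then u z.1 else ((u z.1).1, (prev_pt u z.1).2).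

Lemma rect_lo_quadrant z : quadrant (rect_lo z).
Proof.
case: z => a []; have [p1 p2] := prev_pt_quadrant u0 a; split => //=.
Qed.

Lemma rect_hi_quadrant z : quadrant (rect_hi z).
Proof.
case: z => a []; rewrite /rect_hi/=; first exact: u0.
by have [p1 p2] := prev_pt_quadrant u0 a; have [h1 h2] := u0 a; split.
Qed.

Lemma rect_lo_hi z : rect_lo z ⪯ rect_hi z.
Proof.
case: z => a e; have [p1 p2] := prev_pt_quadrant u0 a; have [h1 h2] := u0 a.
by have [l1 l2] := prev_pt_le u0 uchain (leqnn a); case: e; split.
Qed.

(** The rectangles of an earlier region lie below the previous point of a later one, whereas each
    rectangle of the later region exceeds that point in some coordinate. Within a region, the height
    of the previous point separates the two. *)
Lemma rect_trivIset : trivIset setT (fun z => rect (rect_lo z) (rect_hi z)).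
Proof.
have sub a e w : rect (rect_lo (a, e)) (rect_hi (a, e)) w -> w.1 <= (u a).1 /\ w.2 <= (u a).2.
  move=> [/andP[_ w1] /andP[_ w2]]; move: w1 w2; case: e => //= w1 w2; split => //.
  by apply: le_trans w2 _; have [] := prev_pt_le u0 uchain (leqnn a).
have lt (a b : 'I_r.+1) e e' w : (a < b)%N -> rect (rect_lo (a, e)) (rect_hi (a, e)) w ->
    ~ rect (rect_lo (b, e')) (rect_hi (b, e')) w.
  move=> /(le_prev_pt uchain)[l1 l2] /sub[w1 w2] [/andP[w3 _] /andP[w4 _]].
  case: e' w3 w4 => /= w3 w4.
    by have := lt_le_trans w4 (le_trans w2 l2); rewrite ltxx.
  by have := lt_le_trans w3 (le_trans w1 l1); rewrite ltxx.
move=> [a e] [b e'] _ _ [w [wa wb]].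
have [ab|ba|/val_inj ab] := ltngtP a b.
- by case: (lt a b e e' w ab wa wb).
- by case: (lt b a e' e w ba wb wa).
- rewrite -ab in wb *; congr (_, _).
  move: wa wb => [/andP[_ _] /andP[a1 a2]] [/andP[_ _] /andP[b1 b2]].
  case: e e' a1 a2 b1 b2 => -[]//= a1 a2 b1 b2.
    by have := lt_le_trans a1 b2; rewrite ltxx.
  by have := lt_le_trans b1 a2; rewrite ltxx.
Qed.

Context {d} {T : measurableType d} (P : probability T R).
Context (k : nat) (I : {fset R}) (lambda : R -> nat -> R) (M : R -> R * R -> T -> nat).
Hypothesis lambda0 : forall i j, i \in I -> (1 <= j <= k)%N -> 0 < lambda i j.
Hypothesis HM : forall i, i \in I -> is_GPRF P k (lambda i) (M i).
Hypothesis indM : independent_classes P [set` I] (fun i => process_sigma quadrant (M i)).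

Local Notation Z := ('I_r.+1 * bool)%type.
Local Notation X := (I * Z)%type.

Definition count (x : X) : T -> nat := rect_count (M (val x.1)) (rect_lo x.2) (rect_hi x.2).

Definition count_law (x : X) : nat -> R :=
  theta_weight (rect_rate (k := k) (lambda (val x.1)) (rect_lo x.2) (rect_hi x.2)).

Lemma measurable_count x y : measurable [set w | count x w = y].
Proof.
apply: (measurable_rect_count (HM (valP x.1))).
  exact: rect_lo_quadrant.
exact: rect_hi_quadrant.
Qed.

Lemma count_rate_ge0 (x : X) j : 0 <= rect_rate (k := k) (lambda (val x.1)) (rect_lo x.2) (rect_hi x.2) j.
Proof.
by apply: rect_rate_ge0 (rect_lo_hi _) _ => j' /(lambda0 (valP x.1)).
Qed.

Lemma count_law_ge0 x y : 0 <= count_law x y.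
Proof. by apply: theta_weight_ge0 => j; exact: count_rate_ge0. Qed.

(** Two layers: independence of the processes splits the event into one event per [i], and for fixed
    [i] the counts on disjoint rectangles are independent. *)
Lemma count_independent (t : seq X) (y : X -> nat) : uniq t ->
  P (\bigcap_(x in [set` t]) [set w | count x w = y x]) =
  (\prod_(x <- t) count_law x (y x))%:E.
Proof.
move=> ut.
pose t_ (i : R) : seq Z := [seq x.2 | x <- t & val x.1 == i].
pose y_ (i : R) (z : Z) := if insub i is Some i' then y (i', z) else 0.
have y_E (x : X) : y_ (val x.1) x.2 = y x by rewrite /y_ valK; case: x.
have t_P (x : X) : (x.2 \in t_ (val x.1)) = (x \in t).
  apply/mapP/idP => [[x']|xt].
    rewrite mem_filter => /andP[/eqP x1 x't] x2.
    by move: x't; rewrite [x]surjective_pairing x2 -(val_inj x1) -surjective_pairing.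
  by exists x => //; rewrite mem_filter eqxx.
have ut_ i : uniq (t_ i).
  rewrite map_inj_in_uniq ?filter_uniq// => x x'.
  rewrite !mem_filter => /andP[/eqP xi _] /andP[/eqP x'i _] xx'.
  rewrite [x]surjective_pairing [x']surjective_pairing xx'; congr (_, _).
  by apply: val_inj; rewrite xi x'i.
pose E (i : R) := \bigcap_(z in [set` t_ i])
  [set w | rect_count (M i) (rect_lo z) (rect_hi z) w = y_ i z].
have -> : \bigcap_(x in [set` t]) [set w | count x w = y x] =
    \bigcap_(i in [set` (I : seq R)]) E i.
  apply/seteqP; split => w Ew.
    move=> i iI z zt; have := Ew ([` iI]%fset, z).
    by rewrite /= -t_P/= => /(_ zt); rewrite -y_E.
  move=> x xt; have := Ew (val x.1) (valP x.1) x.2; rewrite /= y_E; apply.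
  by rewrite t_P.
rewrite (independent_seq indM (fset_uniq I))//; last first.
  move=> i iI; set G := \bigcup_(z in quadrant) preimage_set_system setT (M i z) measurable.
  apply: (@fin_bigcap_measurable _ (g_sigma_algebraType G)) => // z _.
  apply: rect_count_process_sigma; [exact: rect_lo_quadrant|exact: rect_hi_quadrant].
pose F (x : X) := count_law x (y x).
transitivity (\prod_(i : I) (\prod_(x <- t | x.1 == i) F x)%:E)%E.
  rewrite (big_seq_fsetE _ I xpredT (fun i => P (E i)))/=; apply: eq_bigr => i _.
  rewrite (rect_count_independent (fun j => lambda0 (valP i)) (HM (valP i)) (y_ (val i))
    rect_lo_quadrant rect_hi_quadrant rect_lo_hi rect_trivIset (ut_ (val i))).
  rewrite /t_ big_map big_filter; congr (_%:E).
  apply: eq_big => [x|x /eqP xi]; first by rewrite val_eqE.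
  by rewrite /F -(val_inj xi) y_E.
rewrite prodEFin; congr (_%:E).
under eq_bigr do rewrite big_mkcond.
rewrite exchange_big/=; apply: eq_bigr => x _.
by rewrite -big_mkcond/= (big_pred1 x.1)// => i; rewrite eq_sym.
Qed.

(** Each count is replaced by its Poisson jumps, one direction per region and mark. The rates in a
    direction come from the two rectangles of the region and add up to [lambda] times its area. *)
Lemma skellam_expectation (V : lmodType R) (e : 'I_r.+1 -> V) (g : V -> \bar R) :
  (forall x, 0 <= g x)%E ->
  (\int[P]_w g (\sum_(x <- enum {: X}) (val x.1 *: e x.2.1) *+ count x w)%R =
   multi_pois (shift_dir e) (fun a : 'I_r.+1 * (I * 'I_k) => lambda (val a.2.1) a.2.2.+1 *
     ((u a.1).1 * (u a.1).2 - (prev_pt u a.1).1 * (prev_pt u a.1).2))%R g 0%R)%E.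
Proof.
move=> g0.
rewrite (@integral_sum_labels _ _ _ P V X (enum {: X}) count count_law
  (fun x n => (val x.1 *: e x.2.1) *+ n)); first last.
- exact: g0.
- exact: enum_uniq.
- by move=> t y ut _; apply: count_independent.
- exact: count_law_ge0.
- exact: measurable_count.
pose A := ('I_r.+1 * (I * 'I_k))%type.
pose mu_ (x : X) (j : 'I_k) (a : A) : R := if a == (x.2.1, (x.1, j))
  then rect_rate (lambda (val x.1)) (rect_lo x.2) (rect_hi x.2) j else 0.
have mu0 x j a : 0 <= mu_ x j a by rewrite /mu_; case: ifP => // _; exact: count_rate_ge0.
have mus0 x a : 0 <= \sum_(j <- enum 'I_k) mu_ x j a by apply: sumr_ge0.
have stepE (h : V -> \bar R) x : (forall v, 0 <= h v)%E ->
    shift_avg (count_law x) (fun n => (val x.1 *: e x.2.1) *+ n) h =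
    multi_pois (shift_dir e) (fun a => \sum_(j <- enum 'I_k) mu_ x j a) h.
  move=> h0; rewrite (shift_avg_theta (count_rate_ge0 x) _ h0).
  rewrite -(multi_pois_sum (shift_dir e) _ (mu0 x) h0).
  elim: (enum 'I_k) => [//|j s IH]; rewrite [LHS]/= [RHS]/= IH.
  have h'0 (v : V) : (0 <= foldr (fun j => multi_pois (shift_dir e) (mu_ x j)) h s v)%E.
    by rewrite (multi_pois_sum (shift_dir e) _ (mu0 x) h0); apply: multi_pois_ge0 => // a; apply: sumr_ge0.
  rewrite (multi_pois_single (shift_dir e) (x.2.1, (x.1, j)) (count_rate_ge0 x j) h'0).
  by rewrite /shift_dir /mark_weight/= -scaler_nat scalerA mulrC.
have -> : foldr (fun x => shift_avg (count_law x) (fun n => (val x.1 *: e x.2.1) *+ n))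
    g (enum {: X}) = foldr (fun x => multi_pois (shift_dir e)
      (fun a => \sum_(j <- enum 'I_k) mu_ x j a)) g (enum {: X}).
  elim: (enum {: X}) => [//|x s IH]; rewrite [LHS]/= [RHS]/= IH; apply: stepE => v.
  by rewrite (multi_pois_sum (shift_dir e) _ mus0 g0); apply: multi_pois_ge0 => // a; apply: sumr_ge0.
rewrite (multi_pois_sum (shift_dir e) _ mus0 g0).
congr (_ 0); apply: eq_multi_pois => -[a [i j]] /=.
transitivity (\sum_(b : bool) rect_rate (k := k) (lambda (val i)) (rect_lo (a, b)) (rect_hi (a, b)) j).
  rewrite big_enum/=.
  pose G (x : X) := rect_rate (k := k) (lambda (val x.1)) (rect_lo x.2) (rect_hi x.2) j.
  rewrite -(sum_pair_fst a (fun z => G (i, z))).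
  rewrite -(sum_pair_fst i (fun x => if a == x.2.1 then G x else 0)).
  apply: eq_bigr => x _; rewrite big_enum/= (bigD1 j)//= big1 ?addr0; last first.
    by move=> j' /negbTE jj'; rewrite /mu_ !xpair_eqE [j == j']eq_sym jj' !andbF.
  by rewrite /mu_ !xpair_eqE eqxx andbT /G; case: (i == x.1); case: (a == x.2.1).
(* With [p] the previous point, the two areas [u1 * (u2 - p2)] and [(u1 - p1) * p2] sum to
   [u1 * u2 - p1 * p2]. *)
rewrite big_bool /rect_rate/=; ring.
Qed.

End skellam.

Lemma ae_all_seq {d} {T : measurableType d} {R : realType} (P : probability T R)
    (J : eqType) (s : seq J) (Q : J -> T -> Prop) :
  (forall j, {ae P, forall w, Q j w}) ->
  {ae P, forall w, forall j, j \in s -> Q j w}.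
Proof.
move=> aeQ; elim: s => [|j s IH]; first exact: aeW.
move: (aeQ j) IH; apply: filterS2 => w Qj Qs i.
by rewrite inE => /orP[/eqP ->//|]; apply: Qs.
Qed.

(** Expresses the three integrals by one real number, so that bounds for [K + h] and [K - h] reduce
    to linear arithmetic. *)
Lemma bounded_integral {d} {T : measurableType d} {R : realType} (P : probability T R)
    (h : T -> R) (K : R) :
  measurable_fun setT h -> (forall w, `|h w| <= K) ->
  exists a, [/\ (\int[P]_w (h w)%:E = a%:E)%E,
    (\int[P]_w (K + h w)%:E = (K + a)%:E)%E &
    (\int[P]_w (K - h w)%:E = (K - a)%:E)%E].
Proof.
move=> mh hK.
have Kint : P.-integrable setT (EFin \o cst K).
  by apply: finite_measure_integrable_cst.
have hint : P.-integrable setT (EFin \o h).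
  apply: (le_integrable _ _ _ Kint) => //; first exact/measurable_EFinP.
  by move=> w _; rewrite /= lee_fin (le_trans (hK w))// ler_norm.
have Kcst : (\int[P]_w (EFin \o cst K) w = K%:E)%E.
  rewrite (_ : EFin \o cst K = cst K%:E)// integral_cst//.
  by rewrite [X in (_ * X)%E](@probability_setT _ _ _ P) mule1.
exists (fine (\int[P]_w (h w)%:E)).
have hf : (\int[P]_w (h w)%:E)%E \is a fin_num by exact: integrable_fin_num hint.
rewrite !EFinD EFinN fineK//; split => //.
  under eq_integral do rewrite EFinD.
  by rewrite (integralD measurableT Kint hint) Kcst.
under eq_integral do rewrite EFinB.
by rewrite (integralB measurableT Kint hint) Kcst.
Qed.

(** The boxes to which a cell of region [a] belongs: those from [a] on. *)
Definition chain_vec {R : realType} {r : nat} (a : 'I_r.+1) : 'rV[R]_r.+1 :=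
  \row_b (a <= b)%:R.

Section marks_of_skellam.
Context {R : realType} (r : nat) (u : 'I_r.+1 -> R * R).
Hypothesis u0 : forall a, quadrant (u a).
Hypothesis uchain : forall a b : 'I_r.+1, (a <= b)%N -> u a ⪯ u b.
Context {d} {T : measurableType d} (P : probability T R).
Context (k : nat) (I : {fset R}) (lambda : R -> nat -> R) (M : R -> R * R -> T -> nat).
Hypothesis HM : forall i, i \in I -> is_GPRF P k (lambda i) (M i).
Hypothesis lambda0 : forall i j, i \in I -> (1 <= j <= k)%N -> 0 < lambda i j.

(** Along one step of the chain the field grows by its increments over the two rectangles of the
    region, up to values on the axes. These vanish, and the increments are counts, outside finitely
    many null sets. *)
Lemma skellam_row_ae (S : R * R -> T -> R) :
  (forall z w, quadrant z -> S z w = \sum_(i <- I) i * (M i z w)%:R) ->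
  {ae P, forall w, \row_a S (u a) w =
    \sum_(x <- enum {: I * ('I_r.+1 * bool)})
      (val x.1 *: chain_vec x.2.1) *+ count u M x w}.
Proof.
move=> SE.
have q0 a := prev_pt_quadrant u0 a.
have ax1 : {ae P, forall w, forall (i : I) a, M (val i) (0, (u a).2) w = 0%N}.
  apply: filter_forall => i; apply: filter_forall => a.
  by apply: (GPRF_left0 (HM (valP i))); case: (u0 a).
have ax2 : {ae P, forall w, forall (i : I) a, M (val i) (0, (prev_pt u a).2) w = 0%N}.
  apply: filter_forall => i; apply: filter_forall => a.
  by apply: (GPRF_left0 (HM (valP i))); case: (q0 a).
have ax3 : {ae P, forall w, forall (i : I) a, M (val i) ((u a).1, 0) w = 0%N}.
  apply: filter_forall => i; apply: filter_forall => a.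
  by apply: (GPRF_bottom0 (HM (valP i))); case: (u0 a).
have ax4 : {ae P, forall w, forall (i : I) a, M (val i) ((prev_pt u a).1, 0) w = 0%N}.
  apply: filter_forall => i; apply: filter_forall => a.
  by apply: (GPRF_bottom0 (HM (valP i))); case: (q0 a).
have ax5 : {ae P, forall w, forall (i : I), M (val i) (0, 0) w = 0%N}.
  by apply: filter_forall => i; apply: (GPRF_bottom0 (HM (valP i))).
have cnt : {ae P, forall w, forall x : I * ('I_r.+1 * bool),
    increment (fun z w => (M (val x.1) z w)%:R : R) (rect_lo u x.2) (rect_hi u x.2) w =
    (count u M x w)%:R}.
  apply: filter_forall => x.
  apply: (increment_nat_ae (fun j => lambda0 (valP x.1)) (HM (valP x.1))).
  - exact: rect_lo_quadrant.
  - exact: rect_hi_quadrant.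
  - exact: rect_lo_hi.
have FF : Filter (nbhs (almost_everywhere P)) by exact: ae_filter_ringOfSetsType.
have ax12 := @filterI _ _ FF _ _ ax1 ax2.
have ax34 := @filterI _ _ FF _ _ ax3 ax4.
have ax5c := @filterI _ _ FF _ _ ax5 cnt.
move: ax12 ax34 ax5c; apply: (@filterS3 _ _ FF) => w [h1 h2] [h3 h4] [h5 hc].
apply/rowP => b; rewrite mxE SE; last exact: u0.
rewrite big_enum/= summxE.
transitivity (\sum_(i : I) \sum_(z : 'I_r.+1 * bool)
    val i * (z.1 <= b)%:R * (count u M (i, z) w)%:R).
  rewrite (big_seq_fsetE _ I xpredT (fun i => i * (M i (u b) w)%:R))/=.
  apply: eq_bigr => i _.
  transitivity (\sum_(a : 'I_r.+1) \sum_(e : bool) val i * (a <= b)%:R * (count u M (i, (a, e)) w)%:R); last first.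
    by rewrite pair_big/=; apply: eq_bigr => -[].
  under eq_bigr do rewrite -mulr_sumr -mulrA.
  rewrite -mulr_sumr; congr (_ * _).
  (* Subtracting the vanishing value at the origin makes the sum along the chain telescope. *)
  have -> : (M (val i) (u b) w)%:R = (M (val i) (u b) w)%:R - (M (val i) (0, 0) w)%:R :> R.
    by rewrite h5 subr0.
  rewrite -(@sum_prev_pt _ _ u _ (fun z => (M (val i) z w)%:R : R) b).
  rewrite big_mkcond; apply: eq_bigr => a _.
  case: ifP => ab; last by rewrite mul0r.
  rewrite mul1r big_bool -!hc /increment /rect_lo /rect_hi/=.
  rewrite h1 h2 h3 h4 -!surjective_pairing.
  ring.
rewrite pair_big/=; apply: eq_bigr => -[i z] _ /=.
by rewrite mulmxnE !mxE mulr_natr.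
Qed.

End marks_of_skellam.

(** * Convergence *)

(** The counterpart, for the array, of the decomposition of the Skellam row. *)
Lemma box_sum_row {R : realType} (r : nat) (u : 'I_r.+1 -> R * R) (n : nat)
    (h : nat -> nat -> R) :
  (forall a b : 'I_r.+1, (a <= b)%N -> u a ⪯ u b) ->
  \row_a box_sum n (u a) h =
  \sum_(c <- cells u n) h c.1.+1 c.2.+1 *: chain_vec (region u n c).
Proof.
move=> uchain; apply/rowP => b; rewrite mxE summxE (box_sum_cells _ uchain) big_mkcond.
by apply: eq_bigr => c _; rewrite !mxE; case: ifP => _; rewrite ?mulr1 ?mulr0.
Qed.

Lemma measurable_box_sum {R : realType} {d} {T : measurableType d} (n : nat) (z : R * R)
    (h : nat -> nat -> T -> R) :
  (forall m l, measurable_fun setT (h m l)) ->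
  measurable_fun setT (fun w => box_sum n z (fun m l => h m l w)).
Proof.
by move=> mh; rewrite /box_sum; apply: measurable_sum => m; apply: measurable_sum.
Qed.

Lemma array_independent {R : realType} {d} {T : measurableType d} (P : probability T R)
    (X : nat -> nat -> nat -> {RV P >-> (R * R)%type}) (n : nat) :
  independent_RVs P
    [set x : nat * nat * nat | [/\ (1 <= x.1.1)%N, (1 <= x.1.2)%N & (1 <= x.2)%N]]
    (fun x => X x.1.1 x.1.2 x.2 : T -> R * R) ->
  (1 <= n)%N ->
  forall (t : seq (nat * nat)) (D : nat * nat -> set (R * R)), uniq t ->
    (forall c, measurable (D c)) ->
    P (\bigcap_(c in [set` t]) X n c.1.+1 c.2.+1 @^-1` D c) =
    (\prod_(c <- t) P (X n c.1.+1 c.2.+1 @^-1` D c))%E.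
Proof.
move=> ind n1 t D ut mD.
pose f (c : nat * nat) := (n, c.1.+1, c.2.+1).
pose B (x : nat * nat * nat) := X x.1.1 x.1.2 x.2 @^-1` D (x.1.2.-1, x.2.-1).
have us : uniq (map f t) by rewrite map_inj_uniq// => -[? ?] [? ?] [-> ->].
have := @independent_seq _ _ _ P _ _ _ (map f t) B ind us.
have -> : \bigcap_(x in [set` map f t]) B x =
    \bigcap_(c in [set` t]) X n c.1.+1 c.2.+1 @^-1` D c.
  apply/seteqP; split => w Bw.
    by move=> [m l] ct; have := Bw (f (m, l)); apply; apply: map_f.
  by move=> x /mapP[[m l] ct ->]; exact: Bw ct.
rewrite big_map => -> //.
- by apply: eq_bigr => -[].
- by move=> x /mapP[c _ ->].
- by move=> x /mapP[c _ ->]; exists (D c) => //; rewrite setTI; case: c.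
Qed.

Lemma measurable_GSPP {R : realType} {d} {T : measurableType d} (P : probability T R)
    (k : nat) (I : {fset R}) (lambda : R -> nat -> R) (S : R * R -> T -> R) (z : R * R) :
  is_GSPP P k I lambda S -> quadrant z -> measurable_fun setT (S z).
Proof.
move=> [M [HM _ SE]] qz.
rewrite (_ : S z = fun w => \sum_(i : I) val i * (M (val i) z w)%:R).
  apply: measurable_sum => i; apply: measurable_funM; first exact: measurable_cst.
  by apply: measurable_natr_comp; exact: (GPRF_measurable (HM _ (valP i))).
apply/funext => w; rewrite SE//.
by rewrite (big_seq_fsetE _ I xpredT (fun i => i * (M i z w)%:R)).
Qed.

Section limit.
Context {R : realType} (k : nat) (I : {fset R}) (lambda : R -> nat -> R)
    (p : nat -> nat -> nat -> R -> nat -> R).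
Context {d} {T : measurableType d} (P : probability T R)
    (XY : nat -> nat -> nat -> {RV P >-> (R * R)%type}).
Context {d'} {T' : measurableType d'} (P' : probability T' R) (S : R * R -> T' -> R)
    (r : nat) (u : 'I_r.+1 -> R * R).
Hypothesis I0 : 0 \notin I.
Hypothesis lambda0 : forall i j, i \in I -> (1 <= j <= k)%N -> 0 < lambda i j.
Hypothesis p01 : forall n m l i j, (1 <= n)%N -> (1 <= m)%N -> (1 <= l)%N ->
     i \in I -> (1 <= j <= k)%N -> 0 < p n m l i j < 1.
Hypothesis p1 : forall n m l, (1 <= n)%N -> (1 <= m)%N -> (1 <= l)%N ->
     \sum_(i <- I) \sum_(1 <= j < k.+1) p n m l i j < 1.
Hypothesis indXY : independent_RVs P
    [set x : nat * nat * nat | [/\ (1 <= x.1.1)%N, (1 <= x.1.2)%N & (1 <= x.2)%N]]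
    (fun x => XY x.1.1 x.1.2 x.2 : T -> R * R).
Hypothesis XYp : forall n m l i j, (1 <= n)%N -> (1 <= m)%N -> (1 <= l)%N ->
     i \in I -> (1 <= j <= k)%N ->
     P [set w | XY n m l w = (i, j%:R)] = (p n m l i j)%:E.
Hypothesis XY0 : forall n m l, (1 <= n)%N -> (1 <= m)%N -> (1 <= l)%N ->
     P [set w | [\/ exists2 i, i \in I & XY n m l w = (i, 0),
                    exists2 j, (1 <= j <= k)%N & XY n m l w = (0, j%:R)
                  | XY n m l w = (0, 0)]] =
     (1 - \sum_(i <- I) \sum_(1 <= j < k.+1) p n m l i j)%:E.
Hypothesis pcvg : forall i j, i \in I -> (1 <= j <= k)%N ->
     forall s t, 0 <= s -> 0 <= t ->
     box_sum n (s, t) (fun m l => p n m l i j) @[n --> \oo] --> lambda i j * s * t.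
Hypothesis SP : is_GSPP P' k I lambda S.
Hypothesis u0 : forall a, quadrant (u a).
Hypothesis uchain : forall a b : 'I_r.+1, (a <= b)%N -> u a ⪯ u b.

Local Notation B := (I * 'I_k)%type.
Local Notation A := ('I_r.+1 * B)%type.

Definition mark_prob n (c : nat * nat) (b : B) : R := p n c.1.+1 c.2.+1 (val b.1) b.2.+1.

Lemma mark_probE n m l : \sum_(i <- I) \sum_(1 <= j < k.+1) p n m.+1 l.+1 i j =
  \sum_b mark_prob n (m, l) b.
Proof.
rewrite (big_seq_fsetE _ I xpredT (fun i => \sum_(1 <= j < k.+1) p n m.+1 l.+1 i j))/=.
transitivity (\sum_(i : I) \sum_(j < k) mark_prob n (m, l) (i, j)).
  by apply: eq_bigr => i _; rewrite big_add1/= big_mkord.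
by rewrite pair_big/=; apply: eq_bigr => -[].
Qed.

Lemma mark_prob_ge0 n c b : (1 <= n)%N -> 0 <= mark_prob n c b.
Proof.
move=> n1; have /andP[/ltW//] : 0 < mark_prob n c b < 1.
by apply: p01 => //; [exact: valP|exact: ltn_ord].
Qed.

Definition row_sum n (w : T) : 'rV[R]_r.+1 :=
  \row_(a < r.+1) box_sum n (u a) (fun m l => (XY n m l w).1 * (XY n m l w).2).

Lemma measurable_prod_XY n m l :
  measurable_fun setT (fun w => (XY n m l w).1 * (XY n m l w).2).
Proof.
have mXY := @measurable_funPT _ _ _ _ (XY n m l).
by apply: measurable_funM; apply: measurableT_comp mXY.
Qed.

Lemma row_sum_ae n : (1 <= n)%N -> {ae P, forall w, row_sum n w =
  \sum_(c <- cells u n) label_weight k I (label k I (XY n c.1.+1 c.2.+1) w) *: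
    chain_vec (region u n c)}.
Proof.
move=> n1.
have := @ae_all_seq _ _ _ P _ (cells u n) (fun c w =>
  (XY n c.1.+1 c.2.+1 w).1 * (XY n c.1.+1 c.2.+1 w).2 =
  label_weight k I (label k I (XY n c.1.+1 c.2.+1) w)).
have H (c : nat * nat) : {ae P, forall w,
    (XY n c.1.+1 c.2.+1 w).1 * (XY n c.1.+1 c.2.+1 w).2 =
    label_weight k I (label k I (XY n c.1.+1 c.2.+1) w)}.
  apply: (@prod_label_ae _ _ _ I0 _ _ _ _ (mark_prob n c)).
    by move=> b; apply: XYp => //; [exact: valP|exact: ltn_ord].
  by rewrite XY0// mark_probE; case: c.
move=> /(_ H); apply: filterS => w Hw.
rewrite /row_sum (box_sum_row _ _ uchain); apply: eq_big_seq => c cc.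
by rewrite Hw.
Qed.

Definition cell_rate n (a : A) : R :=
  \sum_(c <- cells u n | region u n c == a.1) mark_prob n c a.2.

Definition limit_rate (a : A) : R := lambda (val a.2.1) a.2.2.+1 *
  ((u a.1).1 * (u a.1).2 - (prev_pt u a.1).1 * (prev_pt u a.1).2).

Definition sqr_error n : R := \sum_(c <- cells u n) (\sum_b mark_prob n c b) ^+ 2.

Lemma row_sum_upper n (C : R) (g : 'rV[R]_r.+1 -> R) : (1 <= n)%N -> 0 <= C ->
  continuous g -> (forall x, 0 <= g x <= C) ->
  (\int[P]_w (g (row_sum n w))%:E <=
   multi_pois (shift_dir chain_vec) (cell_rate n) (EFin \o g) 0%R +
   (C * sqr_error n)%:E)%E.
Proof.
move=> n1 C0 cg gC.
have g0 x : (0 <= (EFin \o g) x)%E by rewrite lee_fin; case/andP: (gC x).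
have gC' x : ((EFin \o g) x <= C%:E)%E by rewrite lee_fin; case/andP: (gC x).
rewrite (@ge0_ae_eq_integral _ _ _ P setT _ (fun w => (EFin \o g)
  (\sum_(c <- cells u n) label_weight k I (label k I (XY n c.1.+1 c.2.+1) w) *:
    chain_vec (region u n c)))); last 6 first.
- exact: measurableT.
- apply/measurable_EFinP; apply: (measurable_continuous_row cg) => a.
  by apply: measurable_box_sum => m l; exact: measurable_prod_XY.
- apply: (@measurable_sum_labels _ _ _ _ _ _ _ _
    (fun c => label k I (XY n c.1.+1 c.2.+1))
    (fun c y => label_weight k I y *: chain_vec (region u n c)) (EFin \o g)) => c y.
  exact: measurable_label.
- by move=> w _; exact: g0.
- by move=> w _; exact: g0.
- have [N [mN PN NS]] := row_sum_ae n1; exists N; split=> // w nw.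
  by apply: NS => rw; apply: nw => _ /=; rewrite rw.
apply: (@array_upper R 'rV[R]_r.+1 k I _ _ _ P _ (cells u n)
  (fun c => XY n c.1.+1 c.2.+1) (mark_prob n) (region u n) chain_vec C (EFin \o g)) => //.
- exact: cells_uniq.
- by move=> c b; exact: mark_prob_ge0.
- by move=> [m l]; rewrite -mark_probE ltW// p1.
- exact: array_independent.
- by move=> c b; apply: XYp => //; [exact: valP|exact: ltn_ord].
Qed.

(** A region is a difference of two boxes, and the assumed convergence applies to each. *)
Lemma cell_rate_cvg a : cell_rate n a @[n --> \oo] --> limit_rate a.
Proof.
case: a => a b.
have h z : quadrant z -> box_sum n z (fun m l => p n m l (val b.1) b.2.+1) @[n --> \oo] -->
    lambda (val b.1) b.2.+1 * z.1 * z.2.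
  move=> [z1 z2]; rewrite [z]surjective_pairing.
  by apply: pcvg => //; [exact: valP|exact: ltn_ord].
rewrite /limit_rate /= mulrBr !mulrA.
have -> : (fun n => cell_rate n (a, b)) = (fun n =>
    box_sum n (u a) (fun m l => p n m l (val b.1) b.2.+1) -
    box_sum n (prev_pt u a) (fun m l => p n m l (val b.1) b.2.+1)).
  by apply/funext => n; rewrite -(box_sum_region _ uchain).
by apply: cvgB; apply: h; [exact: u0|exact: prev_pt_quadrant].
Qed.

(** The total probability of a mark in a cell again has box sums tending to [c * s * t], where [c]
    is the sum of all the [lambda]. *)
Lemma sqr_error_cvg : sqr_error n @[n --> \oo] --> 0.
Proof.
(* The predecessors undo the shift in [mark_prob]; box sums only visit indices at least 1. *)
have -> : sqr_error = (fun n => box_sum n (u ord_max)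
    (fun m l => (\sum_b mark_prob n (m.-1, l.-1) b) ^+ 2)).
  apply/funext => n; rewrite (box_sum_cells _ uchain).
  by apply: eq_big => [c|[m l] _//]; rewrite -ltnS ltn_ord.
have [h1 h2] := u0 ord_max; rewrite [u ord_max]surjective_pairing.
apply: (@box_sum_sqr_cvg0 _ (fun n m l => \sum_b mark_prob n (m.-1, l.-1) b)
  (\sum_(b : B) lambda (val b.1) b.2.+1)) => // [n m l n1 _ _|s t s0 t0].
  by apply: sumr_ge0 => b _; exact: mark_prob_ge0.
have -> : (fun n => box_sum n (s, t) (fun m l => \sum_b mark_prob n (m.-1, l.-1) b)) =
    (fun n => \sum_(b : B) box_sum n (s, t) (fun m l => p n m l (val b.1) b.2.+1)).
  apply/funext => n; rewrite /box_sum [RHS]exchange_big/= big_nat_cond [RHS]big_nat_cond.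
  apply: eq_bigr => m /andP[/andP[m1 _] _].
  rewrite [RHS]exchange_big/= big_nat_cond [RHS]big_nat_cond.
  by apply: eq_bigr => l /andP[/andP[l1 _] _]; apply: eq_bigr => b _; rewrite /mark_prob !prednK.
rewrite mulr_suml mulr_suml; apply: cvg_big => [|b _]; first exact: add_continuous.
by apply: pcvg => //; [exact: valP|exact: ltn_ord].
Qed.

Lemma limit_rate_ge0 a : 0 <= limit_rate a.
Proof.
case: a => a b; rewrite mulr_ge0//; first by apply/ltW/lambda0; [exact: valP|exact: ltn_ord].
have [q1 q2] := prev_pt_quadrant u0 a; have [l1 l2] := prev_pt_le u0 uchain (leqnn a).
by rewrite subr_ge0 ler_pM.
Qed.

Lemma limit_integral (g : 'rV[R]_r.+1 -> R) : continuous g -> (forall x, 0 <= g x) ->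
  (\int[P']_w (g (\row_a S (u a) w))%:E =
   multi_pois (shift_dir chain_vec) limit_rate (EFin \o g) 0%R)%E.
Proof.
move=> cg g0; have [M [HM indM SE]] := SP.
have g0' x : (0 <= (EFin \o g) x)%E by rewrite lee_fin.
rewrite -(skellam_expectation u0 uchain lambda0 HM indM _ g0').
apply: ge0_ae_eq_integral => //.
- apply/measurable_EFinP; apply: (measurable_continuous_row cg) => a.
  exact: measurable_GSPP SP (u0 a).
- apply: (@measurable_sum_labels _ _ _ _ _ _ _ _ (count u M)
    (fun x n => (val x.1 *: chain_vec x.2.1) *+ n) (EFin \o g)) => x y.
  exact: (measurable_count u0 HM).
- by move=> w _; exact: g0'.
- have SE' z w : quadrant z -> S z w = \sum_(i <- I) i * (M i z w)%:R by exact: SE.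
  have [N [mN PN NS]] := skellam_row_ae u0 uchain HM lambda0 SE'.
  exists N; split=> // w nw.
  by apply: NS => rw; apply: nw => _ /=; rewrite rw.
Qed.

(** Two errors, each multiplied by [C], fall below [e] together: the distance from the rates of the
    array to their limits, and the sum of squares. *)
Lemma row_sum_limsup (C e : R) (g : 'rV[R]_r.+1 -> R) : 0 <= C -> 0 < e ->
  continuous g -> (forall x, 0 <= g x <= C) ->
  \forall n \near \oo, (\int[P]_w (g (row_sum n w))%:E <=
     \int[P']_w (g (\row_a S (u a) w))%:E + e%:E)%E.
Proof.
move=> C0 e0 cg gC.
have g0 x : 0 <= g x by case/andP: (gC x).
have g0' x : (0 <= (EFin \o g) x)%E by rewrite lee_fin.
have gC' x : ((EFin \o g) x <= C%:E)%E by rewrite lee_fin; case/andP: (gC x).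
rewrite limit_integral//.
have : C * (\sum_(a : A) `|cell_rate n a - limit_rate a|) + C * sqr_error n
    @[n --> \oo] --> C * (\sum_(a : A) 0) + C * 0.
  apply: cvgD; apply: cvgMr.
    apply: (cvg_sumr (f := fun a n => `|cell_rate n a - limit_rate a|)) => a.
    by rewrite -(normr0 R) -(subrr (limit_rate a)); apply: cvg_norm; apply: cvgB;
      [exact: cell_rate_cvg|exact: cvg_cst].
  exact: sqr_error_cvg.
rewrite big1// !mulr0 addr0 => /cvgr_lt/(_ _ e0) H; near=> n.
have n1 : (1 <= n)%N by near: n; exact: nbhs_infty_gt.
apply: (le_trans (row_sum_upper n1 C0 cg gC)).
have cr0 a : 0 <= cell_rate n a by apply: sumr_ge0 => c _; exact: mark_prob_ge0.
apply: (le_trans (leeD2r _ (multi_pois_continuous (shift_dir chain_vec) cr0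
  limit_rate_ge0 C0 g0' gC' 0))).
rewrite -addeA -EFinD; apply: leeD2l; rewrite lee_fin ltW//.
by near: n.
Unshelve. all: by end_near.
Qed.

End limit.

Theorem theorem5p1 (R : realType) (k : nat) (I : {fset R})
    (lambda : R -> nat -> R)
    (p : nat -> nat -> nat -> R -> nat -> R)
    (d : measure_display) (Omega : measurableType d) (P : probability Omega R)
    (XY : nat -> nat -> nat -> {RV P >-> (R * R)%type})
    (d' : measure_display) (Omega' : measurableType d')
    (P' : probability Omega' R) (S : R * R -> Omega' -> R)
    (r : nat) (u : 'I_r -> R * R) :
  (1 <= k)%N ->
  0 \notin I ->
  (forall i j, i \in I -> (1 <= j <= k)%N -> 0 < lambda i j) ->
  (forall n m l i j, (1 <= n)%N -> (1 <= m)%N -> (1 <= l)%N ->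
     i \in I -> (1 <= j <= k)%N -> 0 < p n m l i j < 1) ->
  (forall n m l, (1 <= n)%N -> (1 <= m)%N -> (1 <= l)%N ->
     \sum_(i <- I) \sum_(1 <= j < k.+1) p n m l i j < 1) ->
  independent_RVs P
    [set x : nat * nat * nat |
       [/\ (1 <= x.1.1)%N, (1 <= x.1.2)%N & (1 <= x.2)%N]]
    (fun x => XY x.1.1 x.1.2 x.2 : Omega -> R * R) ->
  (forall n m l i j, (1 <= n)%N -> (1 <= m)%N -> (1 <= l)%N ->
     i \in I -> (1 <= j <= k)%N ->
     P [set w | XY n m l w = (i, j%:R)] = (p n m l i j)%:E) ->
  (forall n m l, (1 <= n)%N -> (1 <= m)%N -> (1 <= l)%N ->
     P [set w | [\/ exists2 i, i \in I & XY n m l w = (i, 0),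
                    exists2 j, (1 <= j <= k)%N & XY n m l w = (0, j%:R)
                  | XY n m l w = (0, 0)]] =
     (1 - \sum_(i <- I) \sum_(1 <= j < k.+1) p n m l i j)%:E) ->
  (forall i j, i \in I -> (1 <= j <= k)%N ->
     forall s t, 0 <= s -> 0 <= t ->
     box_sum n (s, t) (fun m l => p n m l i j) @[n --> \oo]
       --> lambda i j * s * t) ->
  (forall i j, i \in I -> (1 <= j <= k)%N ->
     sup [set x | exists m l, [/\ (1 <= m <= n)%N, (1 <= l <= n)%N
                                & x = p n m l i j]] @[n --> \oo] --> (0 : R)) ->
  is_GSPP P' k I lambda S ->
  (1 <= r)%N ->
  (forall a, quadrant (u a)) ->
  (forall a b : 'I_r, (a <= b)%N -> u a ⪯ u b) ->
  cvg_in_distribution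
    P (fun n w => \row_(a < r)
         box_sum n (u a) (fun m l => (XY n m l w).1 * (XY n m l w).2))
    P' (fun w => \row_(a < r) S (u a) w).
Proof.
move=> _ I0 lambda0 p01 p1 indXY XYp XY0 pcvg _ SP + u0 uchain f cf [K [Kreal fK]].
case: r u u0 uchain f cf fK => [//|r] u u0 uchain f cf fK _.
(* [bounded_fun] bounds [f] by every number strictly above [K], hence the [+ 1]. *)
pose K1 := `|K| + 1.
have fK1 x : `|f x| <= K1 by apply: (fK K1) => //; rewrite (le_lt_trans (ler_norm K))// ltrDl.
have K10 : 0 <= K1 by rewrite addr_ge0.
have fplus x : 0 <= K1 + f x <= K1 + K1.
  by have := fK1 x; rewrite ler_norml => /andP[h1 h2]; rewrite lerD2l h2 andbT addrC -lerBlDr sub0r.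
have fminus x : 0 <= K1 - f x <= K1 + K1.
  by have := fK1 x; rewrite ler_norml => /andP[h1 h2]; rewrite subr_ge0 h2 lerD2l lerNl.
have limsup g C e := @row_sum_limsup R k I lambda p _ _ P XY _ _ P' S r u I0 lambda0 p01
  p1 indXY XYp XY0 pcvg SP u0 uchain C e g.
have mZ n : measurable_fun setT (fun w => f (row_sum XY u n w)).
  apply: (measurable_continuous_row cf) => a.
  by apply: measurable_box_sum => m l; exact: measurable_prod_XY.
have mS : measurable_fun setT (fun w => f (\row_a S (u a) w)).
  apply: (measurable_continuous_row cf) => a.
  exact: measurable_GSPP SP (u0 a).
have [b [Sb Sbp Sbm]] := bounded_integral P' mS (fun w => fK1 _).
have [a_ Za] := choice (fun n => bounded_integral P (mZ n) (fun w => fK1 _)).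
have -> : (fun n => 'E_P[f \o row_sum XY u n])%E = EFin \o a_.
  by apply/funext => n; rewrite unlock; have [] := Za n.
have -> : ('E_P'[f \o (fun w => \row_a S (u a) w)] = b%:E)%E by rewrite unlock.
apply: cvg_EFin; first by near=> n.
apply/cvgrPdist_le => e e0; near=> n.
have [Zn Znp Znm] := Za n.
have up : a_ n <= b + e.
  have : (\int[P]_w (K1 + f (row_sum XY u n w))%:E <=
      \int[P']_w (K1 + f (\row_a S (u a) w))%:E + e%:E)%E.
    near: n; apply: (limsup (fun x => K1 + f x) (K1 + K1)) => //.
      by rewrite addr_ge0.
    by move=> x; exact: (continuousD (f := cst K1) (cst_continuous (x0 := x)) (cf x)).
  by rewrite Znp Sbp -EFinD lee_fin; lra.
have lo : b <= a_ n + e.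
  have : (\int[P]_w (K1 - f (row_sum XY u n w))%:E <=
      \int[P']_w (K1 - f (\row_a S (u a) w))%:E + e%:E)%E.
    near: n; apply: (limsup (fun x => K1 - f x) (K1 + K1)) => //.
      by rewrite addr_ge0.
    by move=> x; exact: (continuousB (f := cst K1) (cst_continuous (x0 := x)) (cf x)).
  by rewrite Znm Sbm -EFinD lee_fin; lra.
by rewrite /= ler_norml; apply/andP; split; lra.
Unshelve. all: by end_near.
Qed.
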